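(* For every rig signature $(\mathcal S,\Sigma)$ there exists a monoidal signature $(\mathcal S,\Sigma_M)$ (with the same set of sorts) such that the free sesquistrict finite biproduct rig categories generated by $(\mathcal S,\Sigma)$ and by $(\mathcal S,\Sigma_M)$ are isomorphic.
   Context: A rig signature $(\mathcal S,\Sigma)$ consists of a set $\mathcal S$ of sorts and a set $\Sigma$ of generators, each $s\in\Sigma$ with an arity and a coarity which are terms of the grammar $X::=A\mid 1\mid 0\mid X\otimes X\mid X\oplus X$ ($A\in\mathcal S$) modulo the equations: $\otimes$ and $\oplus$ are associative with units $1$ and $0$ respectively, $(X\oplus Y)\otimes Z=(X\otimes Z)\oplus(Y\otimes Z)$, $0\otimes X=0=X\otimes 0$, and $A\otimes(Y\oplus Z)=(A\otimes Y)\oplus(A\otimes Z)$ for $A\in\mathcal S$ (equivalently, arities/coarities are non-commutative polynomials $\bigoplus_i U_i$ with $U_i\in\mathcal S^\star$). A monoidal signature is a rig signature in which all arities and coarities are words in $\mathcal S^\star$. A finite biproduct (fb) category is a symmetric monoidal category $(\mathsf C,\oplus,0)$ with, for each $X$, a commutative monoid $\nabla_X,\mathsf i_X$ and a cocommutative comonoid $\Delta_X,!_X$, coherent with $\oplus$, natural in $X$ (equivalently $\oplus$ is a biproduct). A rig category is a category with two symmetric monoidal structures $(\otimes,1)$, $(\oplus,0)$ and natural isomorphisms $\delta^l_{X,Y,Z}:X\otimes(Y\oplus Z)\to(X\otimes Y)\oplus(X\otimes Z)$, $\delta^r_{X,Y,Z}:(X\oplus Y)\otimes Z\to(X\otimes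 Z)\oplus(Y\otimes Z)$, $0\otimes X\to0$, $X\otimes 0\to 0$ satisfying Laplaza's coherence axioms; (right) strict if both monoidal structures are strict and $\delta^r$ and annihilators are identities; fb if $(\oplus,0)$ is fb. A sesquistrict fb rig category is a functor $H:\mathsf M\to\mathsf D$ with $\mathsf M$ discrete and $\mathsf D$ a strict fb rig category such that $\delta^l_{H(A),X,Y}$ is an identity for all $A\in\mathsf M$. A sesquistrict rig functor from $H:\mathsf M\to\mathsf D$ to $H':\mathsf M'\to\mathsf D'$ is a pair $(\alpha:\mathsf M\to\mathsf M',\beta:\mathsf D\to\mathsf D')$, $\beta$ a strict rig functor, with $\alpha;H'=H;\beta$. An interpretation of a rig signature in $H$ is a pair of functions $\alpha_{\mathcal S}:\mathcal S\to\mathrm{Ob}(\mathsf M)$, $\alpha_\Sigma:\Sigma\to\mathrm{Ar}(\mathsf D)$ such that $\alpha_\Sigma(s)$ goes from $(\alpha_{\mathcal S};H)^\sharp(\mathit{ar}(s))$ to $(\alpha_{\mathcal S};H)^\sharp(\mathit{coar}(s))$, where $(-)^\sharp$ is the extension to terms preserving $\otimes,\oplus,1,0$. $H$ is freely generated by the signature if there is an interpretation $(\alpha_{\mathcal S},\alpha_\Sigma)$ in $H$ such that for every sesquistrict fb rig category $H'$ and interpretation $(\alpha'_{\mathcal S},\alpha'_\Sigma)$ in $H'$ there is a unique sesquistrict rig functor $(\alpha,\beta)$ with $\alpha_{\mathcal S};\alpha=\alpha'_{\mathcal S}$ and $\alpha_\Sigma;\beta=\alpha'_\Sigma$. Free sesquistrict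 fb rig categories generated by a signature are unique up to isomorphism. *)

(* Defs.v *)
From Stdlib Require Import List.
Import ListNotations.

Set Implicit Arguments.
Unset Strict Implicit.
Unset Printing Implicit Defensive.

Record category : Type := Category {
  Ob : Type;
  Hom : Ob -> Ob -> Type;
  idm : forall X, Hom X X;
  comp : forall X Y Z, Hom X Y -> Hom Y Z -> Hom X Z;
  comp_idl : forall X Y (f : Hom X Y), comp (idm X) f = f;
  comp_idr : forall X Y (f : Hom X Y), comp f (idm Y) = f;
  comp_assoc : forall W X Y Z (f : Hom W X) (g : Hom X Y) (h : Hom Y Z),
    comp (comp f g) h = comp f (comp g h) }.

Arguments idm {c} X.
Arguments comp {c X Y Z} f g.

Notation "f ;; g" := (comp f g) (at level 60, right associativity).

(* Two arrows whose endpoints are only propositionally equal are compared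
   as elements of [Arr C]; [arr f = arr g] entails that the endpoints agree. *)
Record Arr (C : category) : Type := arr {
  dom : Ob C;
  cod : Ob C;
  arr_hom : Hom dom cod }.

Arguments arr {C dom cod} arr_hom.

Definition is_identity (C : category) (X Y : Ob C) (f : Hom X Y) : Prop :=
  arr f = arr (idm X).

Record iso (C : category) (X Y : Ob C) : Type := Iso {
  fwd :> Hom X Y;
  bwd : Hom Y X;
  fwd_bwd : fwd ;; bwd = idm X;
  bwd_fwd : bwd ;; fwd = idm Y }.

Definition discrete (C : category) : Prop :=
  forall (X Y : Ob C) (f : Hom X Y), is_identity f.

Record functor (C D : category) : Type := Functor {
  fob :> Ob C -> Ob D;
  fmap : forall X Y, Hom X Y -> Hom (fob X) (fob Y);
  fmap_id : forall X, fmap (idm X) = idm (fob X);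
  fmap_comp : forall X Y Z (f : Hom X Y) (g : Hom Y Z),
    fmap (f ;; g) = fmap f ;; fmap g }.

Arguments fmap {C D} f0 {X Y} f.

Definition farr (C D : category) (F : functor C D) (f : Arr C) : Arr D :=
  arr (fmap F (arr_hom f)).

Definition functor_eq (C D : category) (F G : functor C D) : Prop :=
  (forall X : Ob C, F X = G X) /\ (forall f : Arr C, farr F f = farr G f).

Definition functor_id (C : category) : functor C C.
Proof.
exact (@Functor C C (fun X => X) (fun X Y f => f)
         (fun X => eq_refl) (fun X Y Z f g => eq_refl)).
Defined.

Definition functor_comp (C D E : category) (F : functor C D) (G : functor D E) :
  functor C E.
Proof.
refine (@Functor C E (fun X => G (F X)) (fun X Y f => fmap G (fmap F f)) _ _).
- intro X; rewrite fmap_id; apply fmap_id.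
- intros X Y Z f g; rewrite fmap_comp; apply fmap_comp.
Defined.

Record symmetric_monoidal (C : category) : Type := SymmetricMonoidal {
  tob : Ob C -> Ob C -> Ob C;
  tunit : Ob C;
  thom : forall X X' Y Y', Hom X X' -> Hom Y Y' -> Hom (tob X Y) (tob X' Y');
  thom_id : forall X Y, thom (idm X) (idm Y) = idm (tob X Y);
  thom_comp : forall X X' X'' Y Y' Y''
    (f : Hom X X') (f' : Hom X' X'') (g : Hom Y Y') (g' : Hom Y' Y''),
    thom (f ;; f') (g ;; g') = thom f g ;; thom f' g';
  assoc : forall X Y Z, iso (tob (tob X Y) Z) (tob X (tob Y Z));
  lunit : forall X, iso (tob tunit X) X;
  runit : forall X, iso (tob X tunit) X;
  swap : forall X Y, Hom (tob X Y) (tob Y X);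
  assoc_nat : forall X X' Y Y' Z Z' (f : Hom X X') (g : Hom Y Y') (h : Hom Z Z'),
    thom (thom f g) h ;; assoc X' Y' Z' = assoc X Y Z ;; thom f (thom g h);
  lunit_nat : forall X X' (f : Hom X X'),
    thom (idm tunit) f ;; lunit X' = lunit X ;; f;
  runit_nat : forall X X' (f : Hom X X'),
    thom f (idm tunit) ;; runit X' = runit X ;; f;
  swap_nat : forall X X' Y Y' (f : Hom X X') (g : Hom Y Y'),
    thom f g ;; swap X' Y' = swap X Y ;; thom g f;
  pentagon : forall W X Y Z,
    thom (assoc W X Y) (idm Z) ;; assoc W (tob X Y) Z ;; thom (idm W) (assoc X Y Z)
    = assoc (tob W X) Y Z ;; assoc W X (tob Y Z);
  triangle : forall X Y,
    assoc X tunit Y ;; thom (idm X) (lunit Y) = thom (runit X) (idm Y);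
  swap_swap : forall X Y, swap X Y ;; swap Y X = idm (tob X Y);
  hexagon : forall X Y Z,
    assoc X Y Z ;; swap X (tob Y Z) ;; assoc Y Z X
    = thom (swap X Y) (idm Z) ;; assoc Y X Z ;; thom (idm Y) (swap X Z) }.

Arguments tob {C} s X Y.
Arguments tunit {C} s.
Arguments thom {C} s {X X' Y Y'} f g.
Arguments assoc {C} s X Y Z.
Arguments lunit {C} s X.
Arguments runit {C} s X.
Arguments swap {C} s X Y.

Definition strict_monoidal (C : category) (S : symmetric_monoidal C) : Prop :=
  (forall X Y Z, is_identity (assoc S X Y Z)) /\
  (forall X, is_identity (lunit S X)) /\
  (forall X, is_identity (runit S X)).

Definition interchange (C : category) (S : symmetric_monoidal C) (W X Y Z : Ob C) :
  Hom (tob S (tob S W X) (tob S Y Z)) (tob S (tob S W Y) (tob S X Z)) :=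
  assoc S W X (tob S Y Z) ;;
  thom S (idm W) (bwd (assoc S X Y Z) ;;
                  thom S (swap S X Y) (idm Z) ;;
                  assoc S Y X Z) ;;
  bwd (assoc S W Y (tob S X Z)).

Record strict_monoidal_functor (C D : category)
  (S : symmetric_monoidal C) (T : symmetric_monoidal D) (F : functor C D) :
  Prop := StrictMonoidalFunctor {
  smf_tob : forall X Y, F (tob S X Y) = tob T (F X) (F Y);
  smf_tunit : F (tunit S) = tunit T;
  smf_thom : forall X X' Y Y' (f : Hom X X') (g : Hom Y Y'),
    arr (fmap F (thom S f g)) = arr (thom T (fmap F f) (fmap F g));
  smf_assoc : forall X Y Z,
    arr (fmap F (assoc S X Y Z)) = arr (assoc T (F X) (F Y) (F Z));
  smf_lunit : forall X, arr (fmap F (lunit S X)) = arr (lunit T (F X));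
  smf_runit : forall X, arr (fmap F (runit S X)) = arr (runit T (F X));
  smf_swap : forall X Y, arr (fmap F (swap S X Y)) = arr (swap T (F X) (F Y)) }.

Record finite_biproduct (C : category) (S : symmetric_monoidal C) : Type :=
FiniteBiproduct {
  merge : forall X, Hom (tob S X X) X;
  init : forall X, Hom (tunit S) X;
  copy : forall X, Hom X (tob S X X);
  discard : forall X, Hom X (tunit S);
  merge_assoc : forall X,
    thom S (merge X) (idm X) ;; merge X
    = assoc S X X X ;; thom S (idm X) (merge X) ;; merge X;
  merge_initl : forall X, thom S (init X) (idm X) ;; merge X = lunit S X;
  merge_initr : forall X, thom S (idm X) (init X) ;; merge X = runit S X;
  merge_swap : forall X, swap S X X ;; merge X = merge X;
  copy_assoc : forall X,
    copy X ;; thom S (copy X) (idm X) ;; assoc S X X X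
    = copy X ;; thom S (idm X) (copy X);
  copy_discardl : forall X, copy X ;; thom S (discard X) (idm X) = bwd (lunit S X);
  copy_discardr : forall X, copy X ;; thom S (idm X) (discard X) = bwd (runit S X);
  copy_swap : forall X, copy X ;; swap S X X = copy X;
  merge_tob : forall X Y,
    merge (tob S X Y) = interchange S X Y X Y ;; thom S (merge X) (merge Y);
  merge_tunit : merge (tunit S) = lunit S (tunit S);
  init_tob : forall X Y,
    init (tob S X Y) = bwd (lunit S (tunit S)) ;; thom S (init X) (init Y);
  init_tunit : init (tunit S) = idm (tunit S);
  copy_tob : forall X Y,
    copy (tob S X Y) = thom S (copy X) (copy Y) ;; interchange S X X Y Y;
  copy_tunit : copy (tunit S) = bwd (lunit S (tunit S));
  discard_tob : forall X Y,
    discard (tob S X Y) = thom S (discard X) (discard Y) ;; lunit S (tunit S);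
  discard_tunit : discard (tunit S) = idm (tunit S);
  merge_nat : forall X Y (f : Hom X Y), thom S f f ;; merge Y = merge X ;; f;
  init_nat : forall X Y (f : Hom X Y), init X ;; f = init Y;
  copy_nat : forall X Y (f : Hom X Y), f ;; copy Y = copy X ;; thom S f f;
  discard_nat : forall X Y (f : Hom X Y), f ;; discard Y = discard X }.

Record bimonoidal : Type := Bimonoidal {
  bcat :> category;
  mul : symmetric_monoidal bcat;
  add : symmetric_monoidal bcat }.

Notation "X ⊗ Y" := (tob (mul _) X Y) (at level 40, left associativity).
Notation "X ⊕ Y" := (tob (add _) X Y) (at level 50, left associativity).
Notation "f ⊠ g" := (thom (mul _) f g) (at level 40, left associativity).
Notation "f ⊞ g" := (thom (add _) f g) (at level 50, left associativity).
Notation "'𝟙'" := (tunit (mul _)).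
Notation "'𝟘'" := (tunit (add _)).

(* The coherence axioms are numbered as in Laplaza,
   "Coherence for distributivity" (1972). *)
Record rig_structure (R : bimonoidal) : Type := RigStructure {
  distl : forall X Y Z : Ob R, iso (X ⊗ (Y ⊕ Z)) (X ⊗ Y ⊕ X ⊗ Z);
  distr : forall X Y Z : Ob R, iso ((X ⊕ Y) ⊗ Z) (X ⊗ Z ⊕ Y ⊗ Z);
  annl : forall X : Ob R, iso (𝟘 ⊗ X) 𝟘;
  annr : forall X : Ob R, iso (X ⊗ 𝟘) 𝟘;
  distl_nat : forall (X X' Y Y' Z Z' : Ob R)
    (f : Hom X X') (g : Hom Y Y') (h : Hom Z Z'),
    f ⊠ (g ⊞ h) ;; distl X' Y' Z' = distl X Y Z ;; (f ⊠ g ⊞ f ⊠ h);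
  distr_nat : forall (X X' Y Y' Z Z' : Ob R)
    (f : Hom X X') (g : Hom Y Y') (h : Hom Z Z'),
    (f ⊞ g) ⊠ h ;; distr X' Y' Z' = distr X Y Z ;; (f ⊠ h ⊞ g ⊠ h);
  annl_nat : forall (X X' : Ob R) (f : Hom X X'),
    idm 𝟘 ⊠ f ;; annl X' = annl X;
  annr_nat : forall (X X' : Ob R) (f : Hom X X'),
    f ⊠ idm 𝟘 ;; annr X' = annr X;
  laplaza_I : forall A B C : Ob R,
    distl A B C ;; swap (add R) (A ⊗ B) (A ⊗ C)
    = idm A ⊠ swap (add R) B C ;; distl A C B;
  laplaza_II : forall A B C : Ob R,
    distr A B C ;; (swap (mul R) A C ⊞ swap (mul R) B C)
    = swap (mul R) (A ⊕ B) C ;; distl C A B;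
  laplaza_III : forall A B C : Ob R,
    distr A B C ;; swap (add R) (A ⊗ C) (B ⊗ C)
    = swap (add R) A B ⊠ idm C ;; distr B A C;
  laplaza_IV : forall A B C D : Ob R,
    distr (A ⊕ B) C D ;; (distr A B D ⊞ idm (C ⊗ D)) ;;
      assoc (add R) (A ⊗ D) (B ⊗ D) (C ⊗ D)
    = assoc (add R) A B C ⊠ idm D ;; distr A (B ⊕ C) D ;;
      (idm (A ⊗ D) ⊞ distr B C D);
  laplaza_V : forall A B C D : Ob R,
    distl A (B ⊕ C) D ;; (distl A B C ⊞ idm (A ⊗ D)) ;;
      assoc (add R) (A ⊗ B) (A ⊗ C) (A ⊗ D)
    = idm A ⊠ assoc (add R) B C D ;; distl A B (C ⊕ D) ;;
      (idm (A ⊗ B) ⊞ distl A C D);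
  laplaza_VI : forall A B C D : Ob R,
    distl (A ⊗ B) C D ;; (assoc (mul R) A B C ⊞ assoc (mul R) A B D)
    = assoc (mul R) A B (C ⊕ D) ;; idm A ⊠ distl B C D ;;
      distl A (B ⊗ C) (B ⊗ D);
  laplaza_VII : forall A B C D : Ob R,
    distr A B C ⊠ idm D ;; distr (A ⊗ C) (B ⊗ C) D ;;
      (assoc (mul R) A C D ⊞ assoc (mul R) B C D)
    = assoc (mul R) (A ⊕ B) C D ;; distr A B (C ⊗ D);
  laplaza_VIII : forall A B C D : Ob R,
    distl A B C ⊠ idm D ;; distr (A ⊗ B) (A ⊗ C) D ;;
      (assoc (mul R) A B D ⊞ assoc (mul R) A C D)
    = assoc (mul R) A (B ⊕ C) D ;; idm A ⊠ distr B C D ;;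
      distl A (B ⊗ D) (C ⊗ D);
  laplaza_IX : forall A B C D : Ob R,
    distr A B (C ⊕ D) ;; (distl A C D ⊞ distl B C D) ;;
      interchange (add R) (A ⊗ C) (A ⊗ D) (B ⊗ C) (B ⊗ D)
    = distl (A ⊕ B) C D ;; (distr A B C ⊞ distr A B D);
  laplaza_X : fwd (annl 𝟘) = fwd (annr 𝟘);
  laplaza_XI : forall A B : Ob R,
    distl 𝟘 A B ;; (annl A ⊞ annl B) ;; lunit (add R) 𝟘 = annl (A ⊕ B);
  laplaza_XII : forall A B : Ob R,
    distr A B 𝟘 ;; (annr A ⊞ annr B) ;; lunit (add R) 𝟘 = annr (A ⊕ B);
  laplaza_XIII : fwd (annl 𝟙) = fwd (runit (mul R) 𝟘);
  laplaza_XIV : fwd (annr 𝟙) = fwd (lunit (mul R) 𝟘);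
  laplaza_XV : forall A : Ob R, swap (mul R) A 𝟘 ;; annl A = annr A;
  laplaza_XVI : forall A B : Ob R,
    assoc (mul R) 𝟘 A B ;; annl (A ⊗ B) = annl A ⊠ idm B ;; annl B;
  laplaza_XVII : forall A B : Ob R,
    assoc (mul R) A 𝟘 B ;; idm A ⊠ annl B ;; annr A
    = annr A ⊠ idm B ;; annl B;
  laplaza_XVIII : forall A B : Ob R,
    assoc (mul R) A B 𝟘 ;; idm A ⊠ annr B ;; annr A = annr (A ⊗ B);
  laplaza_XIX : forall A B : Ob R,
    distl A 𝟘 B ;; (annr A ⊞ idm (A ⊗ B)) ;; lunit (add R) (A ⊗ B)
    = idm A ⊠ lunit (add R) B;
  laplaza_XX : forall A B : Ob R,
    distr 𝟘 B A ;; (annl A ⊞ idm (B ⊗ A)) ;; lunit (add R) (B ⊗ A)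
    = lunit (add R) B ⊠ idm A;
  laplaza_XXI : forall A B : Ob R,
    distl A B 𝟘 ;; (idm (A ⊗ B) ⊞ annr A) ;; runit (add R) (A ⊗ B)
    = idm A ⊠ runit (add R) B;
  laplaza_XXII : forall A B : Ob R,
    distr B 𝟘 A ;; (idm (B ⊗ A) ⊞ annl A) ;; runit (add R) (B ⊗ A)
    = runit (add R) B ⊠ idm A;
  laplaza_XXIII : forall A B : Ob R,
    distl 𝟙 A B ;; (lunit (mul R) A ⊞ lunit (mul R) B) = lunit (mul R) (A ⊕ B);
  laplaza_XXIV : forall A B : Ob R,
    distr A B 𝟙 ;; (runit (mul R) A ⊞ runit (mul R) B) = runit (mul R) (A ⊕ B) }.

Arguments distl {R} r X Y Z.
Arguments distr {R} r X Y Z.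
Arguments annl {R} r X.
Arguments annr {R} r X.

Record rig_category : Type := RigCategory {
  rbim :> bimonoidal;
  rig : rig_structure rbim }.

(* Right strictness: the left distributor is not required to be an identity. *)
Definition strict_rig (R : rig_category) : Prop :=
  strict_monoidal (mul R) /\
  strict_monoidal (add R) /\
  (forall X Y Z : Ob R, is_identity (distr (rig R) X Y Z)) /\
  (forall X : Ob R, is_identity (annl (rig R) X)) /\
  (forall X : Ob R, is_identity (annr (rig R) X)).

Record fb_rig_category : Type := FbRigCategory {
  frig :> rig_category;
  fb : finite_biproduct (add frig) }.

Record strict_rig_functor (R R' : rig_category) : Type := StrictRigFunctor {
  srf :> functor R R';
  srf_mul : strict_monoidal_functor (mul R) (mul R') srf;
  srf_add : strict_monoidal_functor (add R) (add R') srf;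
  srf_distl : forall X Y Z : Ob R,
    arr (fmap srf (distl (rig R) X Y Z)) = arr (distl (rig R') (srf X) (srf Y) (srf Z));
  srf_distr : forall X Y Z : Ob R,
    arr (fmap srf (distr (rig R) X Y Z)) = arr (distr (rig R') (srf X) (srf Y) (srf Z));
  srf_annl : forall X : Ob R,
    arr (fmap srf (annl (rig R) X)) = arr (annl (rig R') (srf X));
  srf_annr : forall X : Ob R,
    arr (fmap srf (annr (rig R) X)) = arr (annr (rig R') (srf X)) }.

Record sesquistrict : Type := Sesquistrict {
  base : category;
  base_discrete : discrete base;
  total : fb_rig_category;
  total_strict : strict_rig total;
  incl : functor base total;
  incl_distl : forall (A : Ob base) (X Y : Ob total),
    is_identity (distl (rig total) (incl A) X Y) }.

Arguments incl : clear implicits.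

Record sesquistrict_functor (H H' : sesquistrict) : Type := SesquistrictFunctor {
  on_base : functor (base H) (base H');
  on_total : strict_rig_functor (total H) (total H');
  on_incl : functor_eq (functor_comp on_base (incl H'))
                       (functor_comp (incl H) on_total) }.

Definition sesquistrict_functor_eq (H H' : sesquistrict)
  (F G : sesquistrict_functor H H') : Prop :=
  functor_eq (on_base F) (on_base G) /\ functor_eq (on_total F) (on_total G).

Definition isomorphic (H H' : sesquistrict) : Prop :=
  exists (F : sesquistrict_functor H H') (G : sesquistrict_functor H' H),
    functor_eq (functor_comp (on_base F) (on_base G)) (functor_id (base H)) /\
    functor_eq (functor_comp (on_base G) (on_base F)) (functor_id (base H')) /\
    functor_eq (functor_comp (on_total F) (on_total G)) (functor_id (total H)) /\
    functor_eq (functor_comp (on_total G) (on_total F)) (functor_id (total H')).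

Inductive rig_term (S : Type) : Type :=
| TSort (A : S)
| TOne
| TZero
| TMul (X Y : rig_term S)
| TAdd (X Y : rig_term S).

Arguments TOne {S}.
Arguments TZero {S}.

Inductive rig_eq (S : Type) : rig_term S -> rig_term S -> Prop :=
| req_refl X : rig_eq X X
| req_sym X Y : rig_eq X Y -> rig_eq Y X
| req_trans X Y Z : rig_eq X Y -> rig_eq Y Z -> rig_eq X Z
| req_mul X X' Y Y' : rig_eq X X' -> rig_eq Y Y' -> rig_eq (TMul X Y) (TMul X' Y')
| req_add X X' Y Y' : rig_eq X X' -> rig_eq Y Y' -> rig_eq (TAdd X Y) (TAdd X' Y')
| req_mulA X Y Z : rig_eq (TMul (TMul X Y) Z) (TMul X (TMul Y Z))
| req_mul1l X : rig_eq (TMul TOne X) X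
| req_mul1r X : rig_eq (TMul X TOne) X
| req_addA X Y Z : rig_eq (TAdd (TAdd X Y) Z) (TAdd X (TAdd Y Z))
| req_add0l X : rig_eq (TAdd TZero X) X
| req_add0r X : rig_eq (TAdd X TZero) X
| req_distr X Y Z : rig_eq (TMul (TAdd X Y) Z) (TAdd (TMul X Z) (TMul Y Z))
| req_mul0l X : rig_eq (TMul TZero X) TZero
| req_mul0r X : rig_eq (TMul X TZero) TZero
| req_distl A Y Z :
    rig_eq (TMul (TSort A) (TAdd Y Z)) (TAdd (TMul (TSort A) Y) (TMul (TSort A) Z)).

(* Non-commutative polynomials: the list [U_1; ...; U_n] of words stands for
   the sum of the U_i.  By [rig_type_quotient] and [rig_type_surj] below this
   is the quotient of [rig_term S] by [rig_eq], [rig_class] being the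
   projection. *)
Definition rig_type (S : Type) : Type := list (list S).

Definition rig_type_mul (S : Type) (P Q : rig_type S) : rig_type S :=
  flat_map (fun U => map (app U) Q) P.

Fixpoint rig_class (S : Type) (X : rig_term S) : rig_type S :=
  match X with
  | TSort A => [[A]]
  | TOne => [[]]
  | TZero => []
  | TMul X Y => rig_type_mul (rig_class X) (rig_class Y)
  | TAdd X Y => rig_class X ++ rig_class Y
  end.

Definition sharp (R : rig_category) (S : Type) (a : S -> Ob R) (P : rig_type S) :
  Ob R :=
  fold_right
    (fun U X => fold_right (fun A Y => a A ⊗ Y) 𝟙 U ⊕ X) 𝟘 P.

(* The extension of [a] to terms; it factors through [sharp] ([sharp_class]). *)
Fixpoint sharp_term (R : rig_category) (S : Type) (a : S -> Ob R) (X : rig_term S) :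
  Ob R :=
  match X with
  | TSort A => a A
  | TOne => 𝟙
  | TZero => 𝟘
  | TMul X Y => sharp_term a X ⊗ sharp_term a Y
  | TAdd X Y => sharp_term a X ⊕ sharp_term a Y
  end.

Record rig_signature (S : Type) : Type := RigSignature {
  gen : Type;
  ar : gen -> rig_type S;
  coar : gen -> rig_type S }.

Definition is_word (S : Type) (P : rig_type S) : Prop := exists U : list S, P = [U].

Definition is_monoidal (S : Type) (Sig : rig_signature S) : Prop :=
  forall s : gen Sig, is_word (ar s) /\ is_word (coar s).

Record interpretation (S : Type) (Sig : rig_signature S) (H : sesquistrict) :
  Type := Interpretation {
  int_sort : S -> Ob (base H);
  int_gen : gen Sig -> Arr (total H);
  int_dom : forall s, dom (int_gen s) = sharp (fun A => incl H (int_sort A)) (ar s);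
  int_cod : forall s, cod (int_gen s) = sharp (fun A => incl H (int_sort A)) (coar s) }.

Definition extends (S : Type) (Sig : rig_signature S) (H H' : sesquistrict)
  (i : interpretation Sig H) (i' : interpretation Sig H')
  (F : sesquistrict_functor H H') : Prop :=
  (forall A : S, on_base F (int_sort i A) = int_sort i' A) /\
  (forall s : gen Sig, farr (on_total F) (int_gen i s) = int_gen i' s).

Definition freely_generated (S : Type) (Sig : rig_signature S) (H : sesquistrict) :
  Prop :=
  exists i : interpretation Sig H,
    forall (H' : sesquistrict) (i' : interpretation Sig H'),
      exists F : sesquistrict_functor H H',
        extends i i' F /\
        forall G : sesquistrict_functor H H',
          extends i i' G -> sesquistrict_functor_eq F G.

Section RigType.
Variable S : Type.
Implicit Types (X Y Z : rig_term S) (U V : list S) (P Q : rig_type S).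

Definition word_term U : rig_term S :=
  fold_right (fun A X => TMul (TSort A) X) TOne U.

Definition rig_rep P : rig_term S :=
  fold_right (fun U X => TAdd (word_term U) X) TZero P.

Lemma class_word U : rig_class (word_term U) = [U].
Proof.
induction U as [|A U IH]; [reflexivity|].
now simpl; rewrite IH.
Qed.

Lemma class_rep P : rig_class (rig_rep P) = P.
Proof.
induction P as [|U P IH]; [reflexivity|].
now simpl; rewrite IH, class_word.
Qed.

Theorem rig_type_surj P : exists X, rig_class X = P.
Proof. exists (rig_rep P); apply class_rep. Qed.

Lemma type_mulDl P Q R :
  rig_type_mul (P ++ Q) R = rig_type_mul P R ++ rig_type_mul Q R.
Proof. apply flat_map_app. Qed.

Lemma type_mul_map U P Q :
  rig_type_mul (map (app U) P) Q = map (app U) (rig_type_mul P Q).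
Proof.
induction P as [|V P IH]; [reflexivity|]; simpl.
rewrite map_app, <- IH, map_map; f_equal.
apply map_ext; intro W; symmetry; apply app_assoc.
Qed.

Lemma type_mulA P Q R :
  rig_type_mul (rig_type_mul P Q) R = rig_type_mul P (rig_type_mul Q R).
Proof.
induction P as [|U P IH]; [reflexivity|]; simpl.
now rewrite type_mulDl, IH, type_mul_map.
Qed.

Lemma type_mul1r P : rig_type_mul P [[]] = P.
Proof.
induction P as [|U P IH]; [reflexivity|]; simpl.
now rewrite IH, app_nil_r.
Qed.

Lemma type_mul1l P : rig_type_mul [[]] P = P.
Proof. simpl; rewrite app_nil_r; apply map_id. Qed.

Lemma type_mul0r P : rig_type_mul P [] = [].
Proof. now induction P. Qed.

Lemma class_sound X Y : rig_eq X Y -> rig_class X = rig_class Y.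
Proof.
induction 1; simpl; try congruence.
- apply type_mulA.
- exact (type_mul1l _).
- apply type_mul1r.
- symmetry; apply app_assoc.
- apply app_nil_r.
- apply type_mulDl.
- apply type_mul0r.
- now rewrite !app_nil_r, map_app.
Qed.

Lemma rep_add P Q : rig_eq (rig_rep (P ++ Q)) (TAdd (rig_rep P) (rig_rep Q)).
Proof.
induction P as [|U P IH]; simpl.
- apply req_sym, req_add0l.
- apply req_trans with (TAdd (word_term U) (TAdd (rig_rep P) (rig_rep Q))).
  + apply req_add; [apply req_refl | exact IH].
  + apply req_sym, req_addA.
Qed.

Lemma rep_app U V : rig_eq (word_term (U ++ V)) (TMul (word_term U) (word_term V)).
Proof.
induction U as [|A U IH]; simpl.
- apply req_sym, req_mul1l.
- eapply req_trans; [apply req_mul; [apply req_refl | exact IH]|].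
  apply req_sym, req_mulA.
Qed.

Lemma word_distl U Y Z :
  rig_eq (TMul (word_term U) (TAdd Y Z))
         (TAdd (TMul (word_term U) Y) (TMul (word_term U) Z)).
Proof.
induction U as [|A U IH]; simpl.
- eapply req_trans; [apply req_mul1l|].
  apply req_add; apply req_sym, req_mul1l.
- eapply req_trans; [apply req_mulA|].
  eapply req_trans; [apply req_mul; [apply req_refl | exact IH]|].
  eapply req_trans; [apply req_distl|].
  apply req_add; apply req_sym, req_mulA.
Qed.

Lemma rep_map U Q :
  rig_eq (rig_rep (map (app U) Q)) (TMul (word_term U) (rig_rep Q)).
Proof.
induction Q as [|V Q IH]; simpl.
- apply req_sym, req_mul0r.
- eapply req_trans; [apply req_add; [apply rep_app | exact IH]|].
  apply req_sym, word_distl.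
Qed.

Lemma rep_mul P Q :
  rig_eq (rig_rep (rig_type_mul P Q)) (TMul (rig_rep P) (rig_rep Q)).
Proof.
induction P as [|U P IH]; simpl.
- apply req_sym, req_mul0l.
- eapply req_trans; [apply rep_add|].
  eapply req_trans; [apply req_add; [apply rep_map | exact IH]|].
  apply req_sym, req_distr.
Qed.

Lemma rep_class X : rig_eq X (rig_rep (rig_class X)).
Proof.
induction X as [A| | |X IHX Y IHY|X IHX Y IHY]; simpl.
- apply req_sym.
  eapply req_trans; [apply req_add0r | apply req_mul1r].
- apply req_sym, req_add0r.
- apply req_refl.
- eapply req_trans; [apply req_mul; [exact IHX | exact IHY]|].
  apply req_sym, rep_mul.
- eapply req_trans; [apply req_add; [exact IHX | exact IHY]|].
  apply req_sym, rep_add.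
Qed.

Theorem rig_type_quotient X Y : rig_eq X Y <-> rig_class X = rig_class Y.
Proof.
split; [apply class_sound|]; intro e.
eapply req_trans; [apply rep_class|].
rewrite e; apply req_sym, rep_class.
Qed.

End RigType.

Lemma is_identity_ob (C : category) (X Y : Ob C) (f : Hom X Y) :
  is_identity f -> Y = X.
Proof. intro e; exact (f_equal (@cod C) e). Qed.

Section SharpTerm.
Variables (H : sesquistrict) (S : Type) (a : S -> Ob (base H)).
Let b (A : S) : Ob (total H) := incl H (a A).

Lemma sharp_term_eq (X Y : rig_term S) :
  rig_eq X Y -> sharp_term b X = sharp_term b Y.
Proof.
destruct (total_strict H) as
  ((mA & m1l & m1r) & (aA & a0l & a0r) & dr & nl & nr).
induction 1; simpl; try congruence;
  try (symmetry; apply (is_identity_ob (mA _ _ _)));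
  try (symmetry; apply (is_identity_ob (aA _ _ _))).
- symmetry; apply (is_identity_ob (m1l _)).
- symmetry; apply (is_identity_ob (m1r _)).
- symmetry; apply (is_identity_ob (a0l _)).
- symmetry; apply (is_identity_ob (a0r _)).
- symmetry; apply (is_identity_ob (dr _ _ _)).
- symmetry; apply (is_identity_ob (nl _)).
- symmetry; apply (is_identity_ob (nr _)).
- symmetry; apply (is_identity_ob (@incl_distl H _ _ _)).
Qed.

Lemma sharp_term_rep (P : rig_type S) : sharp_term b (rig_rep P) = sharp b P.
Proof.
induction P as [|U P IH]; [reflexivity|].
simpl; rewrite IH; f_equal; clear.
now induction U as [|A U IH]; [|simpl; rewrite IH].
Qed.

Theorem sharp_class (X : rig_term S) : sharp b (rig_class X) = sharp_term b X.
Proof.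
rewrite <- sharp_term_rep; symmetry; apply sharp_term_eq, rep_class.
Qed.

End SharpTerm.

(* Main.v *)
(* A morphism between sums of words is, by the biproduct structure, the same
   thing as the matrix of its components, which are morphisms between words.
   Hence interpretations of a signature in a sesquistrict fb rig category
   correspond, naturally in the latter, to interpretations of the monoidal
   signature with one generator for each entry of each generator, and the free
   category over the former is free over the latter.

   The free category exists by a semantic construction: its objects are the
   polynomials and its arrows are raw expressions, identified when they have the
   same value under every interpretation.  Every law then holds because it holds
   in each interpretation, and no congruence has to be axiomatized.  Raw
   expressions carry no types, so the strict equalities between objects need no
   coercions in the syntax. *)

From Stdlib Require Import List Lia ProofIrrelevance ClassicalEpsilon
  FunctionalExtensionality PropExtensionality.
Import ListNotations.
Require Import Defs.

Set Implicit Arguments.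
Unset Strict Implicit.
Unset Printing Implicit Defensive.

(** * Arrows with arbitrary endpoints *)

Section Arrows.
Variable C : category.
Implicit Types (a b c : Arr C) (X Y Z : Ob C).

Definition aid X : Arr C := arr (idm X).

(* Composition is made total: the junk value [a] is returned when the endpoints
   do not match. *)
Definition acomp a b : Arr C :=
  match excluded_middle_informative (dom b = cod a) with
  | left e => arr (arr_hom a ;; eq_rect (dom b) (fun X => Hom X (cod b)) (arr_hom b) _ e)
  | right _ => a
  end.

(** The way back from [Arr C] to a fixed hom-type; by [arr_ahom] the transport leaves no trace in
    [Arr C]. *)
Definition ahom X Y a (eX : dom a = X) (eY : cod a = Y) : Hom X Y :=
  match eX in _ = X, eY in _ = Y return Hom X Y with
  | eq_refl, eq_refl => arr_hom a
  end.

Lemma arr_ahom X Y a (eX : dom a = X) (eY : cod a = Y) : arr (ahom eX eY) = a.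
Proof. now destruct eX, eY, a. Qed.

(** Uniqueness of identity proofs removes the two endpoint equations. Laws between parallel
    morphisms can therefore be moved to [Arr C], where no transports occur, and back. *)
Lemma arr_inj X Y (f g : Hom X Y) : arr f = arr g -> f = g.
Proof.
intro e; injection e as e.
now apply inj_pair2 in e; apply inj_pair2 in e.
Qed.

Lemma arr_comp X Y Z (f : Hom X Y) (g : Hom Y Z) :
  arr (f ;; g) = acomp (arr f) (arr g).
Proof.
unfold acomp; destruct excluded_middle_informative as [e|ne]; [|now destruct ne].
now simpl in e; rewrite (UIP_refl _ _ e).
Qed.

Lemma dom_acomp a b : dom (acomp a b) = dom a.
Proof. now unfold acomp; destruct excluded_middle_informative. Qed.

Lemma cod_acomp a b : cod a = dom b -> cod (acomp a b) = cod b.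
Proof. now unfold acomp; destruct excluded_middle_informative; [|intro e; destruct n]. Qed.

Lemma acompA a b c : cod a = dom b -> cod b = dom c ->
  acomp (acomp a b) c = acomp a (acomp b c).
Proof.
destruct a as [X Y f], b as [Y' Z g], c as [Z' W h]; simpl; intros <- <-.
rewrite <- !arr_comp; f_equal; apply comp_assoc.
Qed.

Lemma acomp_idl X a : X = dom a -> acomp (aid X) a = a.
Proof.
destruct a as [Y Z f]; simpl; intros ->.
unfold aid; rewrite <- arr_comp; f_equal; apply comp_idl.
Qed.

Lemma acomp_idr X a : X = cod a -> acomp a (aid X) = a.
Proof.
destruct a as [Y Z f]; simpl; intros ->.
unfold aid; rewrite <- arr_comp; f_equal; apply comp_idr.
Qed.

Lemma bwd_identity X Y (f : iso X Y) : is_identity f -> arr (bwd f) = aid Y.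
Proof.
destruct f as [f g fg gf]; unfold is_identity; simpl; intro e.
pose proof (f_equal (@cod C) e) as eY; simpl in eY; subst Y.
apply arr_inj in e; subst f.
now rewrite comp_idl in fg; subst g.
Qed.

(** Uniqueness of inverses, once the endpoints have been identified. *)
Lemma bwd_arr X Y X' Y' (f : iso X Y) (g : iso X' Y') :
  arr f = arr g -> arr (bwd f) = arr (bwd g).
Proof.
intro e.
pose proof (f_equal (@dom C) e) as eX; simpl in eX; subst X'.
pose proof (f_equal (@cod C) e) as eY; simpl in eY; subst Y'.
apply arr_inj in e; f_equal.
rewrite <- (comp_idl (bwd f)), <- (bwd_fwd g), comp_assoc, <- e, fwd_bwd.
apply comp_idr.
Qed.

End Arrows.

Arguments aid {C} X.

Lemma farr_id (C D : category) (F : functor C D) X : farr F (aid X) = aid (F X).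
Proof. unfold farr, aid; simpl; now rewrite fmap_id. Qed.

Lemma farr_acomp (C D : category) (F : functor C D) (a b : Arr C) :
  cod a = dom b -> farr F (acomp a b) = acomp (farr F a) (farr F b).
Proof.
destruct a as [X Y f], b as [Y' Z g]; simpl; intros <-.
rewrite <- arr_comp; unfold farr; simpl; rewrite fmap_comp; apply arr_comp.
Qed.

(** The image of an isomorphism is an isomorphism, so uniqueness of inverses applies to it. This
    serves the formal inverse of the left distributor. *)
Lemma fmap_bwd_arr (C D : category) (F : functor C D) (X Y : Ob C) (X' Y' : Ob D)
  (f : iso X Y) (g : iso X' Y') :
  arr (fmap F f) = arr g -> arr (fmap F (bwd f)) = arr (bwd g).
Proof.
assert (p : fmap F f ;; fmap F (bwd f) = idm (F X))
  by now rewrite <- fmap_comp, fwd_bwd, fmap_id.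
assert (q : fmap F (bwd f) ;; fmap F f = idm (F Y))
  by now rewrite <- fmap_comp, bwd_fwd, fmap_id.
exact (@bwd_arr D _ _ _ _ (Iso p q) g).
Qed.

(** * Tensor products of arrows in a strict monoidal category *)

Section Monoidal.
Variables (C : category) (M : symmetric_monoidal C).
Implicit Types (a b c : Arr C) (X Y Z : Ob C).

Definition athom a b : Arr C := arr (thom M (arr_hom a) (arr_hom b)).

Lemma arr_thom X X' Y Y' (f : Hom X X') (g : Hom Y Y') :
  arr (thom M f g) = athom (arr f) (arr g).
Proof. reflexivity. Qed.

Lemma athom_id X Y : athom (aid X) (aid Y) = aid (tob M X Y).
Proof. unfold athom, aid; simpl; now rewrite thom_id. Qed.

Lemma athom_comp a a' b b' : cod a = dom a' -> cod b = dom b' ->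
  athom (acomp a a') (acomp b b') = acomp (athom a b) (athom a' b').
Proof.
destruct a as [X X' f], a' as [X1 X'' f'], b as [Y Y' g], b' as [Y1 Y'' g'].
simpl; intros <- <-.
now rewrite <- !arr_comp, <- !arr_thom, <- arr_comp, thom_comp.
Qed.

Hypothesis M_strict : strict_monoidal M.

Lemma tobA X Y Z : tob M (tob M X Y) Z = tob M X (tob M Y Z).
Proof. symmetry; exact (is_identity_ob (proj1 M_strict X Y Z)). Qed.

Lemma tob1l X : tob M (tunit M) X = X.
Proof. symmetry; exact (is_identity_ob (proj1 (proj2 M_strict) X)). Qed.

Lemma tob1r X : tob M X (tunit M) = X.
Proof. symmetry; exact (is_identity_ob (proj2 (proj2 M_strict) X)). Qed.

Lemma arr_assoc X Y Z : arr (assoc M X Y Z) = aid (tob M (tob M X Y) Z).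
Proof. apply M_strict. Qed.

Lemma arr_lunit X : arr (lunit M X) = aid (tob M (tunit M) X).
Proof. apply M_strict. Qed.

Lemma arr_runit X : arr (runit M X) = aid (tob M X (tunit M)).
Proof. apply M_strict. Qed.

Lemma arr_bwd_assoc X Y Z : arr (bwd (assoc M X Y Z)) = aid (tob M X (tob M Y Z)).
Proof. apply bwd_identity, M_strict. Qed.

Lemma arr_bwd_lunit X : arr (bwd (lunit M X)) = aid X.
Proof. apply bwd_identity, M_strict. Qed.

Lemma arr_bwd_runit X : arr (bwd (runit M X)) = aid X.
Proof. apply bwd_identity, M_strict. Qed.

(** Naturality of the associator, both of whose instances are identities by strictness. *)
Lemma athomA a b c : athom (athom a b) c = athom a (athom b c).
Proof.
destruct a as [X X' f], b as [Y Y' g], c as [Z Z' h].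
pose proof (f_equal (@arr C _ _) (assoc_nat M f g h)) as e.
rewrite !arr_comp, !arr_thom, !arr_assoc, acomp_idl, acomp_idr in e;
  [exact e | reflexivity | apply tobA].
Qed.

Lemma athom1l a : athom (aid (tunit M)) a = a.
Proof.
destruct a as [X X' f].
pose proof (f_equal (@arr C _ _) (lunit_nat M f)) as e.
rewrite !arr_comp, !arr_thom, !arr_lunit, acomp_idl, acomp_idr in e;
  [exact e | reflexivity | apply tob1l].
Qed.

Lemma athom1r a : athom a (aid (tunit M)) = a.
Proof.
destruct a as [X X' f].
pose proof (f_equal (@arr C _ _) (runit_nat M f)) as e.
rewrite !arr_comp, !arr_thom, !arr_runit, acomp_idl, acomp_idr in e;
  [exact e | reflexivity | apply tob1r].
Qed.

End Monoidal.

Lemma farr_athom (C D : category) (S : symmetric_monoidal C) (T : symmetric_monoidal D)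
  (F : functor C D) (a b : Arr C) :
  strict_monoidal_functor S T F -> farr F (athom S a b) = athom T (farr F a) (farr F b).
Proof. intro hF; exact (smf_thom hF (arr_hom a) (arr_hom b)). Qed.

(** * Matrices of morphisms *)

Section Biproduct.
Variables (C : category) (M : symmetric_monoidal C) (B : finite_biproduct M).
Hypothesis M_strict : strict_monoidal M.
Implicit Types (a b c f g : Arr C) (X Y Z : Ob C) (Xs Ys : list (Ob C)).

Local Notation "X + Y" := (tob M X Y).
Local Notation "a ** b" := (athom M a b) (at level 40, left associativity).
Local Notation "a ;: b" := (acomp a b) (at level 60, right associativity).
Local Notation ainit X := (arr (init B X)).
Local Notation adiscard X := (arr (discard B X)).
Local Notation amerge X := (arr (merge B X)).
Local Notation acopy X := (arr (copy B X)).

Local Hint Rewrite dom_acomp (@tobA C M M_strict) (@tob1l C M M_strict)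
  (@tob1r C M M_strict) : ends.
(** Endpoints of composites match only up to strict associativity and unit laws, so both sides are
    normalized before they are compared. *)
Ltac ends :=
  simpl; autorewrite with ends; simpl;
  rewrite ?cod_acomp by ends; simpl;
  repeat match goal with
    | e : dom ?f = _ |- context [dom ?f] => rewrite e
    | e : cod ?f = _ |- context [cod ?f] => rewrite e
    end;
  autorewrite with ends; simpl; try congruence.

(** The unit is initial: [init] is natural and is the identity at the unit. *)
Lemma init_unique a : dom a = tunit M -> a = ainit (cod a).
Proof.
destruct a as [X Y f]; simpl; intros ->; f_equal.
now rewrite <- (comp_idl f), <- (init_tunit B), init_nat.
Qed.

Lemma discard_unique a : cod a = tunit M -> a = adiscard (dom a).
Proof.
destruct a as [X Y f]; simpl; intros ->; f_equal.
now rewrite <- (comp_idr f), <- (discard_tunit B), discard_nat.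
Qed.

(** Strictness turns every associator in [interchange] into an identity; only the inner symmetry
    survives. *)
Lemma arr_interchange W X Y Z :
  arr (interchange M W X Y Z) = aid W ** (arr (swap M X Y) ** aid Z).
Proof.
unfold interchange.
rewrite ?arr_comp, ?arr_thom, ?arr_comp, ?arr_thom, ?arr_assoc, ?arr_bwd_assoc by assumption.
fold (@aid C W) (@aid C Z).
rewrite (acomp_idr (a := _ ** aid Z)) by ends.
rewrite (acomp_idl (a := _ ** aid Z)) by ends.
rewrite acomp_idr by ends.
apply acomp_idl; ends.
Qed.

Lemma amerge_initl X : ainit X ** aid X ;: amerge X = aid X.
Proof.
pose proof (f_equal (@arr C _ _) (merge_initl B X)) as e.
rewrite arr_comp, arr_thom, arr_lunit, tob1l in e by assumption; exact e.
Qed.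

Lemma amerge_initr X : aid X ** ainit X ;: amerge X = aid X.
Proof.
pose proof (f_equal (@arr C _ _) (merge_initr B X)) as e.
rewrite arr_comp, arr_thom, arr_runit, tob1r in e by assumption; exact e.
Qed.

Lemma acopy_discardl X : acopy X ;: adiscard X ** aid X = aid X.
Proof.
pose proof (f_equal (@arr C _ _) (copy_discardl B X)) as e.
rewrite arr_comp, arr_thom, arr_bwd_lunit in e by assumption; exact e.
Qed.

Lemma acopy_discardr X : acopy X ;: aid X ** adiscard X = aid X.
Proof.
pose proof (f_equal (@arr C _ _) (copy_discardr B X)) as e.
rewrite arr_comp, arr_thom, arr_bwd_runit in e by assumption; exact e.
Qed.

(** By [merge_tob], the merge of a sum is an interchange followed by the two merges. The interchange
    permutes only the inner pair of initial arrows, which cannot be told apart after the swap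
    because they start at the zero object. What is left is a unit law in each summand. *)
Lemma merge_injections X Y :
  (aid X ** ainit Y) ** (ainit X ** aid Y) ;: amerge (X + Y) = aid (X + Y).
Proof.
assert (e : ainit Y ** ainit X ;: arr (swap M Y X) = ainit X ** ainit Y).
{ rewrite (init_unique (a := ainit X ** ainit Y)) by ends.
  rewrite (init_unique (a := _ ;: _)) by ends; ends. }
rewrite merge_tob, arr_comp, arr_thom, arr_interchange.
rewrite <- acompA by ends.
rewrite (athomA M_strict), <- (athomA M_strict (ainit Y)).
rewrite <- athom_comp, acomp_idl by ends.
rewrite <- (athom_comp M (a := _ ** _)), e, acomp_idl by ends.
rewrite (athomA M_strict), <- (athomA M_strict).
rewrite <- athom_comp by ends.
now rewrite amerge_initl, amerge_initr, athom_id.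
Qed.

Lemma copy_projections X Y :
  acopy (X + Y) ;: (aid X ** adiscard Y) ** (adiscard X ** aid Y) = aid (X + Y).
Proof.
assert (e : arr (swap M X Y) ;: adiscard Y ** adiscard X = adiscard X ** adiscard Y).
{ rewrite (discard_unique (a := adiscard X ** adiscard Y)) by ends.
  rewrite (discard_unique (a := _ ;: _)) by ends; ends. }
rewrite copy_tob, arr_comp, arr_thom, arr_interchange.
rewrite acompA by ends.
rewrite (athomA M_strict), <- (athomA M_strict (adiscard Y)).
rewrite <- athom_comp, acomp_idl by ends.
rewrite <- (athom_comp M (a' := _ ** _)), e, acomp_idl by ends.
rewrite (athomA M_strict), <- (athomA M_strict).
rewrite <- athom_comp by ends.
now rewrite acopy_discardl, acopy_discardr, athom_id.
Qed.

(** An arrow out of a sum is the copairing of its restrictions: precompose with [merge_injections]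
    and move [f] past the merge by naturality. [split_cod] is the dual. *)
Lemma split_dom X Y f : dom f = X + Y ->
  f = (aid X ** ainit Y ;: f) ** (ainit X ** aid Y ;: f) ;: amerge (cod f).
Proof.
intro e.
rewrite athom_comp by ends; rewrite acompA by ends.
replace (f ** f ;: amerge (cod f)) with (amerge (X + Y) ;: f).
- rewrite <- acompA, merge_injections, acomp_idl by ends; reflexivity.
- destruct f as [X' Z f]; simpl in *; subst X'.
  rewrite <- arr_thom, <- !arr_comp; f_equal; symmetry; apply merge_nat.
Qed.

Lemma split_cod X Y f : cod f = X + Y ->
  f = acopy (dom f) ;: (f ;: aid X ** adiscard Y) ** (f ;: adiscard X ** aid Y).
Proof.
intro e.
rewrite athom_comp by ends; rewrite <- acompA by ends.
replace (acopy (dom f) ;: f ** f) with (f ;: acopy (X + Y)).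
- rewrite acompA, copy_projections, acomp_idr by ends; reflexivity.
- destruct f as [Z X' f]; simpl in *; subst X'.
  rewrite <- arr_thom, <- !arr_comp; f_equal; apply copy_nat.
Qed.

(** The unit law of the merge, precomposed with [a]. It evaluates a copairing on one injection,
    where the other component becomes an initial arrow; the three variants below play the same part
    in [cotuple] and [tuple]. *)
Lemma merge_initial_l a : ainit (cod a) ** a ;: amerge (cod a) = a.
Proof.
transitivity ((aid (tunit M) ** a ;: ainit (cod a) ** aid (cod a)) ;: amerge (cod a)).
- now rewrite <- athom_comp, acomp_idl, acomp_idr by ends.
- rewrite acompA, amerge_initl, athom1l, acomp_idr by ends; reflexivity.
Qed.

Lemma merge_initial_r a : a ** ainit (cod a) ;: amerge (cod a) = a.
Proof.
transitivity ((a ** aid (tunit M) ;: aid (cod a) ** ainit (cod a)) ;: amerge (cod a)).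
- now rewrite <- athom_comp, acomp_idl, acomp_idr by ends.
- rewrite acompA, amerge_initr, athom1r, acomp_idr by ends; reflexivity.
Qed.

Lemma copy_terminal_l a : acopy (dom a) ;: adiscard (dom a) ** a = a.
Proof.
transitivity (acopy (dom a) ;: adiscard (dom a) ** aid (dom a) ;: aid (tunit M) ** a).
- now rewrite <- athom_comp, acomp_idl, acomp_idr by ends.
- rewrite <- acompA, acopy_discardl, athom1l, acomp_idl by ends; reflexivity.
Qed.

Lemma copy_terminal_r a : acopy (dom a) ;: a ** adiscard (dom a) = a.
Proof.
transitivity (acopy (dom a) ;: aid (dom a) ** adiscard (dom a) ;: a ** aid (tunit M)).
- now rewrite <- athom_comp, acomp_idl, acomp_idr by ends.
- rewrite <- acompA, acopy_discardr, athom1r, acomp_idl by ends; reflexivity.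
Qed.

Definition asum Xs : Ob C := fold_right (tob M) (tunit M) Xs.

(* Junk value [aid (tunit M)] when the index is out of range. *)
Fixpoint inj Xs (i : nat) : Arr C :=
  match Xs, i with
  | [], _ => aid (tunit M)
  | X :: Xs, 0 => aid X ** ainit (asum Xs)
  | X :: Xs, S i => ainit X ** inj Xs i
  end.

Fixpoint proj Xs (i : nat) : Arr C :=
  match Xs, i with
  | [], _ => aid (tunit M)
  | X :: Xs, 0 => aid X ** adiscard (asum Xs)
  | X :: Xs, S i => adiscard X ** proj Xs i
  end.

Lemma dom_inj Xs i : dom (inj Xs i) = nth i Xs (tunit M).
Proof.
revert i; induction Xs as [|X Xs IH]; intros [|i]; simpl; auto using tob1r.
rewrite tob1l; auto.
Qed.

Lemma cod_inj Xs i : cod (inj Xs i) = asum Xs.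
Proof.
revert i; induction Xs as [|X Xs IH]; intros [|i]; simpl; auto; now rewrite IH.
Qed.

Lemma dom_proj Xs i : dom (proj Xs i) = asum Xs.
Proof.
revert i; induction Xs as [|X Xs IH]; intros [|i]; simpl; auto; now rewrite IH.
Qed.

Lemma cod_proj Xs i : cod (proj Xs i) = nth i Xs (tunit M).
Proof.
revert i; induction Xs as [|X Xs IH]; intros [|i]; simpl; auto using tob1r.
rewrite tob1l; auto.
Qed.

Hint Rewrite dom_inj cod_inj dom_proj cod_proj : ends.

(** Factors the later injections through the tail by one fixed arrow, as the induction in [inj_ext]
    requires. *)
Lemma inj_S X Xs i :
  inj (X :: Xs) (S i) = inj Xs i ;: ainit X ** aid (asum Xs).
Proof.
rewrite <- (athom1l M_strict (inj Xs i)), <- athom_comp by ends.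
now rewrite acomp_idl, acomp_idr by ends.
Qed.

Lemma proj_S X Xs i :
  proj (X :: Xs) (S i) = adiscard X ** aid (asum Xs) ;: proj Xs i.
Proof.
rewrite <- (athom1l M_strict (proj Xs i)), <- athom_comp by ends.
now rewrite acomp_idl, acomp_idr by ends.
Qed.

(** The injections are jointly epic: [split_dom] peels off one summand at a time, and at the empty
    sum the domain is initial. *)
Lemma inj_ext Xs f g : dom f = asum Xs -> dom g = asum Xs -> cod f = cod g ->
  (forall i, i < length Xs -> inj Xs i ;: f = inj Xs i ;: g) -> f = g.
Proof.
revert f g; induction Xs as [|X Xs IH]; simpl; intros f g df dg cfg h.
- rewrite (init_unique df), (init_unique dg), cfg; reflexivity.
- rewrite (split_dom df), (split_dom dg), <- cfg; f_equal; f_equal.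
  + apply (h 0); lia.
  + apply IH; [ends | ends | ends |]; intros i hi.
    rewrite <- !acompA, <- inj_S by ends; apply (h (S i)); lia.
Qed.

Lemma proj_ext Xs f g : cod f = asum Xs -> cod g = asum Xs -> dom f = dom g ->
  (forall i, i < length Xs -> f ;: proj Xs i = g ;: proj Xs i) -> f = g.
Proof.
revert f g; induction Xs as [|X Xs IH]; simpl; intros f g cf cg dfg h.
- rewrite (discard_unique cf), (discard_unique cg), dfg; reflexivity.
- rewrite (split_cod cf), (split_cod cg), <- dfg; f_equal; f_equal.
  + apply (h 0); lia.
  + apply IH; [ends | ends | ends |]; intros i hi.
    rewrite !acompA, <- proj_S by ends; apply (h (S i)); lia.
Qed.

(** Iterated copairing. The result is a subset type rather than an existential, so that an arrow can
    be extracted from it as data. *)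
Lemma cotuple Xs Y (g : nat -> Arr C) :
  (forall i, i < length Xs -> dom (g i) = nth i Xs (tunit M) /\ cod (g i) = Y) ->
  {f : Arr C | dom f = asum Xs /\ cod f = Y /\
     forall i, i < length Xs -> inj Xs i ;: f = g i}.
Proof.
revert g; induction Xs as [|X Xs IH]; simpl; intros g hg.
- exists (ainit Y); repeat split; intros i hi; lia.
- destruct (IH (fun i => g (S i))) as (f & df & cf & hf).
  { intros i hi; apply (hg (S i)); lia. }
  destruct (hg 0) as [d0 c0]; [lia|].
  exists (g 0 ** f ;: amerge Y); repeat split; [ends | ends |].
  intros [|i] hi.
  + rewrite <- acompA, <- athom_comp, acomp_idl by ends.
    (* The component on the tail is restricted along an initial arrow, hence is itself initial and
       is absorbed by the merge. *)
    rewrite (init_unique (a := _ ;: f)) by ends.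
    rewrite cod_acomp, cf, <- c0 by ends; apply merge_initial_r.
  + destruct (hg (S i)) as [dS cS]; [lia|].
    rewrite <- acompA, <- athom_comp, hf by (ends; lia).
    rewrite (init_unique (a := _ ;: g 0)) by ends.
    rewrite cod_acomp, c0, <- cS by ends; apply merge_initial_l.
Qed.

Lemma tuple Xs Y (g : nat -> Arr C) :
  (forall i, i < length Xs -> cod (g i) = nth i Xs (tunit M) /\ dom (g i) = Y) ->
  {f : Arr C | dom f = Y /\ cod f = asum Xs /\
     forall i, i < length Xs -> f ;: proj Xs i = g i}.
Proof.
revert g; induction Xs as [|X Xs IH]; simpl; intros g hg.
- exists (adiscard Y); repeat split; intros i hi; lia.
- destruct (IH (fun i => g (S i))) as (f & df & cf & hf).
  { intros i hi; apply (hg (S i)); lia. }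
  destruct (hg 0) as [d0 c0]; [lia|].
  exists (acopy Y ;: g 0 ** f); repeat split; [ends | ends |].
  intros [|i] hi.
  + rewrite acompA, <- athom_comp, acomp_idr by ends.
    rewrite (discard_unique (a := f ;: _)) by ends.
    rewrite dom_acomp, df, <- c0 by ends; apply copy_terminal_r.
  + destruct (hg (S i)) as [dS cS]; [lia|].
    rewrite acompA, <- athom_comp, hf by (ends; lia).
    rewrite (discard_unique (a := g 0 ;: _)) by ends.
    rewrite dom_acomp, c0, <- cS by ends; apply copy_terminal_l.
Qed.

Definition entry Xs Ys f (i j : nat) : Arr C := inj Xs i ;: f ;: proj Ys j.

(** The projections are jointly monic and the injections jointly epic. *)
Lemma entry_ext Xs Ys f g :
  dom f = asum Xs -> cod f = asum Ys -> dom g = asum Xs -> cod g = asum Ys ->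
  (forall i j, i < length Xs -> j < length Ys ->
     entry Xs Ys f i j = entry Xs Ys g i j) -> f = g.
Proof.
intros df cf dg cg h.
apply (proj_ext (Xs := Ys)); [assumption | assumption | congruence |].
intros j hj; apply (inj_ext (Xs := Xs)); [ends | ends | ends |].
intros i hi; now apply h.
Qed.

(** Each row is a tuple, and the rows are then cotupled. *)
Lemma matrix Xs Ys (g : nat -> nat -> Arr C) :
  (forall i j, i < length Xs -> j < length Ys ->
     dom (g i j) = nth i Xs (tunit M) /\ cod (g i j) = nth j Ys (tunit M)) ->
  {f : Arr C | dom f = asum Xs /\ cod f = asum Ys /\
     forall i j, i < length Xs -> j < length Ys -> entry Xs Ys f i j = g i j}.
Proof.
intro hg.
(* The bound on [i] is placed inside the subset type, so that the row is a total function of [i];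
   out of range it is an arbitrary arrow. *)
assert (r : forall i, {f : Arr C | i < length Xs ->
  dom f = nth i Xs (tunit M) /\ cod f = asum Ys /\
     forall j, j < length Ys -> f ;: proj Ys j = g i j}).
{ intro i; destruct (excluded_middle_informative (i < length Xs)) as [hi|hi].
  - destruct (tuple (Xs := Ys) (Y := nth i Xs (tunit M)) (g := g i)) as [f hf].
    + intros j hj; now split; apply hg.
    + now exists f.
  - now exists (aid (tunit M)). }
destruct (cotuple (Xs := Xs) (Y := asum Ys) (g := fun i => proj1_sig (r i)))
  as (f & df & cf & hf).
{ intros i hi; now destruct (r i) as [f hf]; simpl; apply hf in hi. }
exists f; split; [assumption | split; [assumption|]]; intros i j hi hj.
unfold entry; rewrite <- acompA, hf by (ends; lia).
now destruct (r i) as [f' hf']; simpl; apply hf'.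
Qed.

Lemma dom_entry Xs Ys f i j : dom (entry Xs Ys f i j) = nth i Xs (tunit M).
Proof. unfold entry; ends. Qed.

Lemma cod_entry Xs Ys f i j : dom f = asum Xs -> cod f = asum Ys ->
  cod (entry Xs Ys f i j) = nth j Ys (tunit M).
Proof. intros df cf; unfold entry; ends. Qed.

End Biproduct.

(** * Preservation of the biproduct structure by strict monoidal functors *)

Section Preservation.
Variables (C D : category) (M : symmetric_monoidal C) (N : symmetric_monoidal D).
Variables (B : finite_biproduct M) (B' : finite_biproduct N).
Hypotheses (M_strict : strict_monoidal M) (N_strict : strict_monoidal N).
Variables (F : functor C D) (F_smf : strict_monoidal_functor M N F).

(** The image starts at the zero object of [D], where an arrow is determined by its codomain. *)
Lemma farr_init X : farr F (arr (init B X)) = arr (init B' (F X)).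
Proof. apply (init_unique B' (a := farr F (arr (init B X)))); apply F_smf. Qed.

Lemma farr_discard X : farr F (arr (discard B X)) = arr (discard B' (F X)).
Proof. apply (discard_unique B' (a := farr F (arr (discard B X)))); apply F_smf. Qed.

Lemma fob_asum Xs : F (asum M Xs) = asum N (map F Xs).
Proof.
induction Xs as [|X Xs IH]; simpl; [apply F_smf|].
now rewrite (smf_tob F_smf), IH.
Qed.

Lemma farr_inj Xs i : farr F (inj B Xs i) = inj B' (map F Xs) i.
Proof.
revert i; induction Xs as [|X Xs IH]; intros [|i]; simpl;
  rewrite ?(farr_athom _ _ F_smf), ?farr_id, ?farr_init, ?fob_asum, ?IH;
  try rewrite (smf_tunit F_smf); reflexivity.
Qed.

Lemma farr_proj Xs i : farr F (proj B Xs i) = proj B' (map F Xs) i.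
Proof.
revert i; induction Xs as [|X Xs IH]; intros [|i]; simpl;
  rewrite ?(farr_athom _ _ F_smf), ?farr_id, ?farr_discard, ?fob_asum, ?IH;
  try rewrite (smf_tunit F_smf); reflexivity.
Qed.

Lemma farr_entry Xs Ys (f : Arr C) i j : dom f = asum M Xs -> cod f = asum M Ys ->
  farr F (entry B Xs Ys f i j) = entry B' (map F Xs) (map F Ys) (farr F f) i j.
Proof.
intros df cf; unfold entry.
now rewrite !farr_acomp, farr_inj, farr_proj
  by now rewrite ?dom_acomp, ?cod_inj, ?dom_proj.
Qed.

(** A strict monoidal functor is not assumed to respect the monoids and comonoids, so this is
    derived. The merge is the copairing of two identities, and [F] preserves injections, so the
    image restricts to the identity on both summands. *)
Lemma farr_merge X : farr F (arr (merge B X)) = arr (merge B' (F X)).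
Proof.
assert (e : farr F (arr (merge B X)) =
            acomp (athom N (aid (F X)) (aid (F X))) (arr (merge B' (F X)))).
2: now rewrite e, athom_id, acomp_idl.
pose proof (smf_tob F_smf X X) as eX.
rewrite (@split_dom _ _ B' N_strict (F X) (F X) (farr F (arr (merge B X))) eX).
cbn [cod farr]; f_equal; f_equal.
- pose proof (f_equal (farr F) (amerge_initr B M_strict X)) as e.
  now rewrite farr_acomp, (farr_athom _ _ F_smf), farr_init, farr_id in e.
- pose proof (f_equal (farr F) (amerge_initl B M_strict X)) as e.
  now rewrite farr_acomp, (farr_athom _ _ F_smf), farr_init, farr_id in e.
Qed.

Lemma farr_copy X : farr F (arr (copy B X)) = arr (copy B' (F X)).
Proof.
assert (e : farr F (arr (copy B X)) =
            acomp (arr (copy B' (F X))) (athom N (aid (F X)) (aid (F X)))).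
2: now rewrite e, athom_id, acomp_idr.
pose proof (smf_tob F_smf X X) as eX.
rewrite (@split_cod _ _ B' N_strict (F X) (F X) (farr F (arr (copy B X))) eX).
cbn [dom farr]; f_equal; f_equal.
- pose proof (f_equal (farr F) (acopy_discardr B M_strict X)) as e.
  now rewrite farr_acomp, (farr_athom _ _ F_smf), farr_discard, farr_id in e.
- pose proof (f_equal (farr F) (acopy_discardl B M_strict X)) as e.
  now rewrite farr_acomp, (farr_athom _ _ F_smf), farr_discard, farr_id in e.
Qed.

End Preservation.

(** * The free category *)

(** The boolean parameter allows the monoidal laws of the free category to be proved once for both
    structures. *)
Definition monoidal_of (R : bimonoidal) (b : bool) : symmetric_monoidal R :=
  if b then mul R else add R.

Definition type_tob (S : Type) (b : bool) : rig_type S -> rig_type S -> rig_type S :=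
  if b then @rig_type_mul S else @app (list S).

Definition type_tunit (S : Type) (b : bool) : rig_type S := if b then [[]] else [].
Arguments type_tunit {S} b.

Lemma type_tobA (S : Type) b (X Y Z : rig_type S) :
  type_tob b (type_tob b X Y) Z = type_tob b X (type_tob b Y Z).
Proof. destruct b; [apply type_mulA | symmetry; apply app_assoc]. Qed.

Lemma type_tob1l (S : Type) b (X : rig_type S) : type_tob b (type_tunit b) X = X.
Proof. destruct b; [apply type_mul1l | reflexivity]. Qed.

Lemma type_tob1r (S : Type) b (X : rig_type S) : type_tob b X (type_tunit b) = X.
Proof. destruct b; [apply type_mul1r | apply app_nil_r]. Qed.

Lemma type_tob_distr (S : Type) (X Y Z : rig_type S) :
  type_tob true (type_tob false X Y) Z =
  type_tob false (type_tob true X Z) (type_tob true Y Z).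
Proof. apply type_mulDl. Qed.

Lemma type_tob_annl (S : Type) (X : rig_type S) :
  type_tob true (type_tunit false) X = type_tunit false.
Proof. reflexivity. Qed.

Lemma type_tob_annr (S : Type) (X : rig_type S) :
  type_tob true X (type_tunit false) = type_tunit false.
Proof. apply type_mul0r. Qed.

Section Strict.
Variable H : sesquistrict.

Lemma monoidal_of_strict b : strict_monoidal (monoidal_of (total H) b).
Proof. destruct b; apply (total_strict H). Qed.

Lemma arr_distr (X Y Z : Ob (total H)) :
  arr (distr (rig (total H)) X Y Z) =
  aid (tob (monoidal_of (total H) true) (tob (monoidal_of (total H) false) X Y) Z).
Proof. apply (total_strict H). Qed.

Lemma arr_bwd_distr (X Y Z : Ob (total H)) :
  arr (bwd (distr (rig (total H)) X Y Z)) =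
  aid (tob (monoidal_of (total H) false) (tob (monoidal_of (total H) true) X Z)
         (tob (monoidal_of (total H) true) Y Z)).
Proof. apply (bwd_identity (f := distr _ X Y Z)), (total_strict H). Qed.

Lemma arr_annl (X : Ob (total H)) :
  arr (annl (rig (total H)) X) =
  aid (tob (monoidal_of (total H) true) (tunit (monoidal_of (total H) false)) X).
Proof. apply (total_strict H). Qed.

Lemma arr_annr (X : Ob (total H)) :
  arr (annr (rig (total H)) X) =
  aid (tob (monoidal_of (total H) true) X (tunit (monoidal_of (total H) false))).
Proof. apply (total_strict H). Qed.

Lemma arr_bwd_annl (X : Ob (total H)) :
  arr (bwd (annl (rig (total H)) X)) = aid (tunit (monoidal_of (total H) false)).
Proof. apply (bwd_identity (f := annl _ X)), (total_strict H). Qed.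

Lemma arr_bwd_annr (X : Ob (total H)) :
  arr (bwd (annr (rig (total H)) X)) = aid (tunit (monoidal_of (total H) false)).
Proof. apply (bwd_identity (f := annr _ X)), (total_strict H). Qed.

Variable b : bool.
Local Notation M := (monoidal_of (total H) b).

Lemma arr_lunit_of (X : Ob (total H)) :
  arr (lunit M X) = aid (tob M (tunit M) X).
Proof. apply arr_lunit, monoidal_of_strict. Qed.

Lemma arr_runit_of (X : Ob (total H)) :
  arr (runit M X) = aid (tob M X (tunit M)).
Proof. apply arr_runit, monoidal_of_strict. Qed.

Lemma arr_assoc_of (X Y Z : Ob (total H)) :
  arr (assoc M X Y Z) = aid (tob M (tob M X Y) Z).
Proof. apply arr_assoc, monoidal_of_strict. Qed.

Lemma arr_bwd_lunit_of (X : Ob (total H)) :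
  arr (bwd (lunit M X)) = aid X.
Proof. apply arr_bwd_lunit, monoidal_of_strict. Qed.

Lemma arr_bwd_runit_of (X : Ob (total H)) :
  arr (bwd (runit M X)) = aid X.
Proof. apply arr_bwd_runit, monoidal_of_strict. Qed.

Lemma arr_bwd_assoc_of (X Y Z : Ob (total H)) :
  arr (bwd (assoc M X Y Z)) = aid (tob M X (tob M Y Z)).
Proof. apply arr_bwd_assoc, monoidal_of_strict. Qed.

End Strict.

(** * Raw expressions, their values, and the quotient *)

Section Free.
Variables (S : Type) (Sig : rig_signature S).
Implicit Types (X Y Z : rig_type S) (b : bool).

(** Associators, unitors, right distributors and annihilators have no constructors: strictness makes
    them identities, which [RId] covers. The left distributor is an identity only in special cases,
    so it appears together with a formal inverse. *)
Inductive raw : Type :=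
| RGen (s : gen Sig)
| RId X
| RComp (t u : raw)
| RTen b (t u : raw)
| RSwap b X Y
| RMerge X
| RInit X
| RCopy X
| RDiscard X
| RDistl X Y Z
| RDistlInv X Y Z.

Arguments type_tob : simpl never.
Arguments type_tunit : simpl never.

Fixpoint rdom (t : raw) : rig_type S :=
  match t with
  | RGen s => ar s
  | RId X => X
  | RComp t u => rdom t
  | RTen b t u => type_tob b (rdom t) (rdom u)
  | RSwap b X Y => type_tob b X Y
  | RMerge X => type_tob false X X
  | RInit X => type_tunit false
  | RCopy X => X
  | RDiscard X => X
  | RDistl X Y Z => type_tob true X (type_tob false Y Z)
  | RDistlInv X Y Z => type_tob false (type_tob true X Y) (type_tob true X Z)
  end.

Fixpoint rcod (t : raw) : rig_type S :=
  match t with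
  | RGen s => coar s
  | RId X => X
  | RComp t u => rcod u
  | RTen b t u => type_tob b (rcod t) (rcod u)
  | RSwap b X Y => type_tob b Y X
  | RMerge X => X
  | RInit X => X
  | RCopy X => type_tob false X X
  | RDiscard X => type_tunit false
  | RDistl X Y Z => type_tob false (type_tob true X Y) (type_tob true X Z)
  | RDistlInv X Y Z => type_tob true X (type_tob false Y Z)
  end.

Fixpoint well_formed (t : raw) : Prop :=
  match t with
  | RComp t u => well_formed t /\ well_formed u /\ rcod t = rdom u
  | RTen _ t u => well_formed t /\ well_formed u
  | _ => True
  end.

Definition typed X Y (t : raw) : Prop := well_formed t /\ rdom t = X /\ rcod t = Y.

Section Evaluation.
Variables (H : sesquistrict) (i : interpretation Sig H).

Definition obj X : Ob (total H) := sharp (fun A => incl H (int_sort i A)) X.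

(** Polynomials are replaced by the classes of their representing terms; [sharp_class] then passes
    to [sharp_term], which preserves both operations by definition. *)
Lemma obj_tob b X Y : obj (type_tob b X Y) = tob (monoidal_of (total H) b) (obj X) (obj Y).
Proof.
unfold obj; rewrite <- (class_rep X), <- (class_rep Y).
transitivity (sharp (fun A => incl H (int_sort i A)) (rig_class
  (if b then TMul (rig_rep X) (rig_rep Y) else TAdd (rig_rep X) (rig_rep Y)))).
- now destruct b.
- now rewrite !sharp_class; destruct b.
Qed.

Lemma obj_tunit b : obj (type_tunit b) = tunit (monoidal_of (total H) b).
Proof.
destruct b; [|reflexivity].
exact (sharp_class (int_sort i) TOne).
Qed.

Fixpoint eval (t : raw) : Arr (total H) :=
  match t with
  | RGen s => int_gen i s
  | RId X => aid (obj X)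
  | RComp t u => acomp (eval t) (eval u)
  | RTen b t u => athom (monoidal_of (total H) b) (eval t) (eval u)
  | RSwap b X Y => arr (swap (monoidal_of (total H) b) (obj X) (obj Y))
  | RMerge X => arr (merge (fb (total H)) (obj X))
  | RInit X => arr (init (fb (total H)) (obj X))
  | RCopy X => arr (copy (fb (total H)) (obj X))
  | RDiscard X => arr (discard (fb (total H)) (obj X))
  | RDistl X Y Z => arr (distl (rig (total H)) (obj X) (obj Y) (obj Z))
  | RDistlInv X Y Z => arr (bwd (distl (rig (total H)) (obj X) (obj Y) (obj Z)))
  end.

(** Well-formedness is what keeps composites in [eval] away from the junk value of [acomp]. *)
Lemma eval_typed t : well_formed t ->
  dom (eval t) = obj (rdom t) /\ cod (eval t) = obj (rcod t).
Proof.
induction t; cbn [rdom rcod dom cod eval well_formed aid athom]; intro wf;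
  rewrite ?obj_tob, ?obj_tunit; try now split.
- split; [apply int_dom | apply int_cod].
- destruct wf as (wt & wu & e), (IHt1 wt) as [dt ct], (IHt2 wu) as [du cu].
  rewrite dom_acomp, cod_acomp by congruence; now split.
- now destruct wf as [wt wu], (IHt1 wt) as [-> ->], (IHt2 wu) as [-> ->].
Qed.

End Evaluation.

(** Endpoints are compared syntactically so that passing to a representative preserves typing. The
    quantification over all models takes place in [Prop], so it does not raise the universe of the
    hom-types built from it. *)
Definition equiv (t u : raw) : Prop :=
  rdom t = rdom u /\ rcod t = rcod u /\
  forall (H : sesquistrict) (i : interpretation Sig H), eval i t = eval i u.

Definition canon (t : raw) : raw :=
  epsilon (inhabits t) (fun u => well_formed u /\ equiv t u).

Lemma canon_spec t : well_formed t -> well_formed (canon t) /\ equiv t (canon t).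
Proof.
intro wf; unfold canon; apply epsilon_spec.
now exists t; repeat split.
Qed.

(** Equivalent expressions have the same equivalence class, as predicates by extensionality, and
    [epsilon] depends only on the predicate. *)
Lemma canon_equiv t u : well_formed t -> well_formed u -> equiv t u -> canon t = canon u.
Proof.
intros wt wu (ed & ec & ev); unfold canon.
replace (fun v => well_formed v /\ equiv u v) with (fun v => well_formed v /\ equiv t v).
(* The two choices are made with different inhabitation witnesses, which do not matter since the
   class is nonempty. *)
- apply epsilon_inh_irrelevance; now exists t; repeat split.
- apply functional_extensionality; intro v; apply propositional_extensionality.
  unfold equiv; rewrite ed, ec.
  split; intros (wv & dv & cv & h); repeat split; auto; intros H i;
    now rewrite <- h, ev.
Qed.

(** The quotient of typed expressions by [equiv], realized by chosen representatives so that
    equality of arrows is plain equality. *)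
Definition fhom X Y : Type := {t : raw | typed X Y t /\ canon t = t}.

Lemma canon_typed X Y t : typed X Y t -> typed X Y (canon t) /\ canon (canon t) = canon t.
Proof.
intros (wt & dt & ct).
destruct (canon_spec wt) as (wc & e); split.
- destruct e as (ed & ec & _); repeat split; congruence.
- symmetry; now apply canon_equiv.
Qed.

Definition cls X Y t (h : typed X Y t) : fhom X Y := exist _ (canon t) (canon_typed h).

Definition ev (H : sesquistrict) (i : interpretation Sig H) X Y (f : fhom X Y) :
  Arr (total H) := eval i (proj1_sig f).

Lemma ev_cls (H : sesquistrict) (i : interpretation Sig H) X Y t (h : typed X Y t) :
  ev i (cls h) = eval i t.
Proof. symmetry; apply (canon_spec (proj1 h)). Qed.

(** Parallel arrows have the same syntactic endpoints, so equal values make their representatives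
    equivalent, and equivalent representatives coincide. Every law of the free structure is proved
    through this lemma. *)
Lemma fhom_ext X Y (f g : fhom X Y) :
  (forall (H : sesquistrict) (i : interpretation Sig H), ev i f = ev i g) -> f = g.
Proof.
destruct f as [t [(wt & dt & ct) et]], g as [u [(wu & du & cu) eu]]; intro h.
assert (e : t = u).
{ rewrite <- et, <- eu; apply canon_equiv; trivial.
  split; [congruence | split; [congruence | exact h]]. }
subst u; f_equal; apply proof_irrelevance.
Qed.

Lemma cls_surj X Y (f : fhom X Y) : exists t (h : typed X Y t), f = cls h.
Proof.
destruct f as [t [h e]]; exists t, h.
apply fhom_ext; intros H i; symmetry; apply ev_cls.
Qed.

Lemma typed_id X : typed X X (RId X).
Proof. now repeat split. Qed.

Lemma typed_comp X Y Z t u : typed X Y t -> typed Y Z u -> typed X Z (RComp t u).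
Proof. intros (wt & dt & ct) (wu & du & cu); repeat split; simpl; congruence. Qed.

Lemma typed_ten b X X' Y Y' t u : typed X X' t -> typed Y Y' u ->
  typed (type_tob b X Y) (type_tob b X' Y') (RTen b t u).
Proof. intros (wt & dt & ct) (wu & du & cu); repeat split; simpl; congruence. Qed.

Definition fid X : fhom X X := cls (typed_id X).

(** The expression is an identity and [e] enters only its typing; all strict structure isomorphisms
    of the free category have this form. *)
Definition fcast X Y (e : X = Y) : fhom X Y :=
  cls (conj I (conj eq_refl e) : typed X Y (RId X)).

Definition fcomp X Y Z (f : fhom X Y) (g : fhom Y Z) : fhom X Z :=
  cls (typed_comp (proj1 (proj2_sig f)) (proj1 (proj2_sig g))).

Definition ften b X X' Y Y' (f : fhom X X') (g : fhom Y Y') :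
  fhom (type_tob b X Y) (type_tob b X' Y') :=
  cls (typed_ten b (proj1 (proj2_sig f)) (proj1 (proj2_sig g))).

Definition fraw X Y t (wt : well_formed t) (d : rdom t = X) (c : rcod t = Y) : fhom X Y :=
  cls (conj wt (conj d c)).

Definition fswap b X Y : fhom (type_tob b X Y) (type_tob b Y X) :=
  @fraw _ _ (RSwap b X Y) I eq_refl eq_refl.

Section Ev.
Variables (H : sesquistrict) (i : interpretation Sig H).

Lemma ev_dom X Y (f : fhom X Y) : dom (ev i f) = obj i X.
Proof. now destruct f as [t [(wt & <- & <-) et]]; apply (eval_typed i wt). Qed.

Lemma ev_cod X Y (f : fhom X Y) : cod (ev i f) = obj i Y.
Proof. now destruct f as [t [(wt & <- & <-) et]]; apply (eval_typed i wt). Qed.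

Definition hom X Y (f : fhom X Y) : Hom (obj i X) (obj i Y) := ahom (ev_dom f) (ev_cod f).

Lemma arr_hom_ev X Y (f : fhom X Y) : arr (hom f) = ev i f.
Proof. apply arr_ahom. Qed.

Lemma ev_id X : ev i (fid X) = aid (obj i X).
Proof. apply ev_cls. Qed.

Lemma ev_cast X Y (e : X = Y) : ev i (fcast e) = aid (obj i X).
Proof. apply ev_cls. Qed.

Lemma ev_comp X Y Z (f : fhom X Y) (g : fhom Y Z) :
  ev i (fcomp f g) = acomp (ev i f) (ev i g).
Proof. apply ev_cls. Qed.

Lemma ev_ten b X X' Y Y' (f : fhom X X') (g : fhom Y Y') :
  ev i (ften b f g) = athom (monoidal_of (total H) b) (ev i f) (ev i g).
Proof. apply ev_cls. Qed.

Lemma ev_raw X Y t (wt : well_formed t) (d : rdom t = X) (c : rcod t = Y) :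
  ev i (fraw wt d c) = eval i t.
Proof. apply ev_cls. Qed.

Lemma ev_swap b X Y :
  ev i (fswap b X Y) = arr (swap (monoidal_of (total H) b) (obj i X) (obj i Y)).
Proof. apply ev_cls. Qed.

End Ev.


Ltac ends :=
  rewrite ?ev_dom, ?ev_cod, ?dom_acomp, ?cod_acomp by (rewrite ?ev_dom, ?ev_cod; auto);
  rewrite ?ev_dom, ?ev_cod; auto.

Definition free_category : category.
Proof.
refine (@Category (rig_type S) fhom fid fcomp _ _ _); intros;
  apply fhom_ext; intros H i; rewrite !ev_comp, ?ev_id.
- apply acomp_idl; ends.
- apply acomp_idr; ends.
- apply acompA; ends.
Defined.

Definition hiso X Y (e : X = Y) : @iso free_category X Y.
Proof.
refine (@Iso free_category X Y (fcast e) (fcast (eq_sym e)) _ _);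
  abstract (destruct e; apply fhom_ext; intros H i; cbn [idm comp free_category];
    rewrite ev_comp, !ev_cast, ?ev_id; now apply acomp_idl).
Defined.

Lemma arr_aid (C : category) (X : Ob C) : arr (idm X) = aid X.
Proof. reflexivity. Qed.

Hint Rewrite arr_lunit_of arr_runit_of arr_assoc_of arr_bwd_lunit_of arr_bwd_runit_of
  arr_bwd_assoc_of arr_distr arr_bwd_distr arr_annl arr_annr arr_bwd_annl arr_bwd_annr
  arr_comp arr_thom arr_aid arr_hom_ev : arrs.
Hint Rewrite ev_id ev_cast ev_comp ev_ten ev_swap ev_raw obj_tob obj_tunit : evs.

(* [p H i] is the wanted law in [H], instantiated at the interpretation [i];
   [unfold_free] exposes the components of the free structure in the goal. *)
Ltac law_by unfold_free p :=
  apply fhom_ext; intros H i;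
  let e := fresh "e" in
  pose proof (f_equal (@arr _ _ _) (p H i)) as e; cbn beta in e;
  change (mul (total H)) with (monoidal_of (total H) true) in e;
  change (add (total H)) with (monoidal_of (total H) false) in e;
  unfold interchange in e |- *;
  autorewrite with arrs in e;
  unfold_free tt;
  autorewrite with evs; cbn [eval rdom rcod]; autorewrite with evs;
  exact e.

Ltac monoidal_law p :=
  law_by ltac:(fun _ => cbn [idm comp free_category hiso fwd bwd]) p.

Definition free_monoidal b : symmetric_monoidal free_category.
Proof.
refine (@SymmetricMonoidal free_category (type_tob b) (type_tunit b) (@ften b) _ _
  (fun X Y Z => hiso (type_tobA b X Y Z)) (fun X => hiso (type_tob1l b X))
  (fun X => hiso (type_tob1r b X)) (fswap b) _ _ _ _ _ _ _ _).
- abstract (intros X Y;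
   monoidal_law (fun H i => thom_id (monoidal_of (total H) b) (obj i X) (obj i Y))).
- abstract (intros X X' X'' Y Y' Y'' f f' g g';
   monoidal_law (fun H i => thom_comp (monoidal_of (total H) b) (hom i f) (hom i f')
    (hom i g) (hom i g'))).
- abstract (intros X X' Y Y' Z Z' f g h;
   monoidal_law (fun H i => assoc_nat (monoidal_of (total H) b) (hom i f) (hom i g)
    (hom i h))).
- abstract (intros X X' f;
   monoidal_law (fun H i => lunit_nat (monoidal_of (total H) b) (hom i f))).
- abstract (intros X X' f;
   monoidal_law (fun H i => runit_nat (monoidal_of (total H) b) (hom i f))).
- abstract (intros X X' Y Y' f g;
   monoidal_law (fun H i => swap_nat (monoidal_of (total H) b) (hom i f) (hom i g))).
- abstract (intros W X Y Z;
   monoidal_law (fun H i => pentagon (monoidal_of (total H) b) (obj i W) (obj i X)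
    (obj i Y) (obj i Z))).
- abstract (intros X Y;
   monoidal_law (fun H i => triangle (monoidal_of (total H) b) (obj i X) (obj i Y))).
- abstract (intros X Y;
   monoidal_law (fun H i => swap_swap (monoidal_of (total H) b) (obj i X) (obj i Y))).
- abstract (intros X Y Z;
   monoidal_law (fun H i => hexagon (monoidal_of (total H) b) (obj i X) (obj i Y)
    (obj i Z))).
Defined.

Definition free_bimonoidal : bimonoidal :=
  @Bimonoidal free_category (free_monoidal true) (free_monoidal false).

Ltac law p :=
  law_by ltac:(fun _ =>
    cbn [idm comp tob tunit thom assoc lunit runit swap free_category free_monoidal
         hiso fwd bwd mul add bcat free_bimonoidal]) p.

Definition fdistl X Y Z : @iso free_category
  (type_tob true X (type_tob false Y Z))
  (type_tob false (type_tob true X Y) (type_tob true X Z)).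
Proof.
refine (@Iso free_category _ _
  (@fraw _ _ (RDistl X Y Z) I eq_refl eq_refl)
  (@fraw _ _ (RDistlInv X Y Z) I eq_refl eq_refl) _ _).
- abstract law (fun H i => fwd_bwd (distl (rig (total H)) (obj i X) (obj i Y) (obj i Z))).
- abstract law (fun H i => bwd_fwd (distl (rig (total H)) (obj i X) (obj i Y) (obj i Z))).
Defined.

Ltac rig_law p :=
  law_by ltac:(fun _ =>
    cbn [idm comp tob tunit thom assoc lunit runit swap free_category free_monoidal
         hiso fwd bwd mul add bcat free_bimonoidal fdistl]) p.

Definition free_rig_structure : rig_structure free_bimonoidal.
Proof.
refine (@RigStructure free_bimonoidal fdistl
  (fun X Y Z => hiso (type_tob_distr X Y Z))
  (fun X => hiso (type_tob_annl X)) (fun X => hiso (type_tob_annr X))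
  _ _ _ _ _ _ _ _ _ _ _ _ _ _ _ _ _ _ _ _ _ _ _ _ _ _ _ _).
- abstract (intros X X' Y Y' Z Z' f g h;
   rig_law (fun H i => distl_nat (rig (total H)) (hom i f) (hom i g) (hom i h))).
- abstract (intros X X' Y Y' Z Z' f g h;
   rig_law (fun H i => distr_nat (rig (total H)) (hom i f) (hom i g) (hom i h))).
- abstract (intros X X' f; rig_law (fun H i => annl_nat (rig (total H)) (hom i f))).
- abstract (intros X X' f; rig_law (fun H i => annr_nat (rig (total H)) (hom i f))).
- abstract (intros A B C;
   rig_law (fun H i => laplaza_I (rig (total H)) (obj i A) (obj i B) (obj i C))).
- abstract (intros A B C;
   rig_law (fun H i => laplaza_II (rig (total H)) (obj i A) (obj i B) (obj i C))).
- abstract (intros A B C;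
   rig_law (fun H i => laplaza_III (rig (total H)) (obj i A) (obj i B) (obj i C))).
- abstract (intros A B C D;
   rig_law (fun H i => laplaza_IV (rig (total H)) (obj i A) (obj i B) (obj i C)
    (obj i D))).
- abstract (intros A B C D;
   rig_law (fun H i => laplaza_V (rig (total H)) (obj i A) (obj i B) (obj i C)
    (obj i D))).
- abstract (intros A B C D;
   rig_law (fun H i => laplaza_VI (rig (total H)) (obj i A) (obj i B) (obj i C)
    (obj i D))).
- abstract (intros A B C D;
   rig_law (fun H i => laplaza_VII (rig (total H)) (obj i A) (obj i B) (obj i C)
    (obj i D))).
- abstract (intros A B C D;
   rig_law (fun H i => laplaza_VIII (rig (total H)) (obj i A) (obj i B) (obj i C)
    (obj i D))).
- abstract (intros A B C D;
   rig_law (fun H i => laplaza_IX (rig (total H)) (obj i A) (obj i B) (obj i C)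
    (obj i D))).
- abstract (rig_law (fun H (_ : interpretation Sig H) => laplaza_X (rig (total H)))).
- abstract (intros A B;
   rig_law (fun H i => laplaza_XI (rig (total H)) (obj i A) (obj i B))).
- abstract (intros A B;
   rig_law (fun H i => laplaza_XII (rig (total H)) (obj i A) (obj i B))).
- abstract (rig_law (fun H (_ : interpretation Sig H) => laplaza_XIII (rig (total H)))).
- abstract (rig_law (fun H (_ : interpretation Sig H) => laplaza_XIV (rig (total H)))).
- abstract (intros A; rig_law (fun H i => laplaza_XV (rig (total H)) (obj i A))).
- abstract (intros A B;
   rig_law (fun H i => laplaza_XVI (rig (total H)) (obj i A) (obj i B))).
- abstract (intros A B;
   rig_law (fun H i => laplaza_XVII (rig (total H)) (obj i A) (obj i B))).
- abstract (intros A B;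
   rig_law (fun H i => laplaza_XVIII (rig (total H)) (obj i A) (obj i B))).
- abstract (intros A B;
   rig_law (fun H i => laplaza_XIX (rig (total H)) (obj i A) (obj i B))).
- abstract (intros A B;
   rig_law (fun H i => laplaza_XX (rig (total H)) (obj i A) (obj i B))).
- abstract (intros A B;
   rig_law (fun H i => laplaza_XXI (rig (total H)) (obj i A) (obj i B))).
- abstract (intros A B;
   rig_law (fun H i => laplaza_XXII (rig (total H)) (obj i A) (obj i B))).
- abstract (intros A B;
   rig_law (fun H i => laplaza_XXIII (rig (total H)) (obj i A) (obj i B))).
- abstract (intros A B;
   rig_law (fun H i => laplaza_XXIV (rig (total H)) (obj i A) (obj i B))).
Defined.

Definition free_rig_category : rig_category := RigCategory free_rig_structure.

Definition free_biproduct : @finite_biproduct free_category (free_monoidal false).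
Proof.
refine (@FiniteBiproduct free_category (free_monoidal false)
  (fun X => @fraw _ _ (RMerge X) I eq_refl eq_refl)
  (fun X => @fraw _ _ (RInit X) I eq_refl eq_refl)
  (fun X => @fraw _ _ (RCopy X) I eq_refl eq_refl)
  (fun X => @fraw _ _ (RDiscard X) I eq_refl eq_refl)
  _ _ _ _ _ _ _ _ _ _ _ _ _ _ _ _ _ _ _ _).
- abstract (intros X; rig_law (fun H i => merge_assoc (fb (total H)) (obj i X))).
- abstract (intros X; rig_law (fun H i => merge_initl (fb (total H)) (obj i X))).
- abstract (intros X; rig_law (fun H i => merge_initr (fb (total H)) (obj i X))).
- abstract (intros X; rig_law (fun H i => merge_swap (fb (total H)) (obj i X))).
- abstract (intros X; rig_law (fun H i => copy_assoc (fb (total H)) (obj i X))).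
- abstract (intros X; rig_law (fun H i => copy_discardl (fb (total H)) (obj i X))).
- abstract (intros X; rig_law (fun H i => copy_discardr (fb (total H)) (obj i X))).
- abstract (intros X; rig_law (fun H i => copy_swap (fb (total H)) (obj i X))).
- abstract (intros X Y;
   rig_law (fun H i => merge_tob (fb (total H)) (obj i X) (obj i Y))).
- abstract (rig_law (fun H (_ : interpretation Sig H) => merge_tunit (fb (total H)))).
- abstract (intros X Y;
   rig_law (fun H i => init_tob (fb (total H)) (obj i X) (obj i Y))).
- abstract (rig_law (fun H (_ : interpretation Sig H) => init_tunit (fb (total H)))).
- abstract (intros X Y;
   rig_law (fun H i => copy_tob (fb (total H)) (obj i X) (obj i Y))).
- abstract (rig_law (fun H (_ : interpretation Sig H) => copy_tunit (fb (total H)))).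
- abstract (intros X Y;
   rig_law (fun H i => discard_tob (fb (total H)) (obj i X) (obj i Y))).
- abstract (rig_law (fun H (_ : interpretation Sig H) => discard_tunit (fb (total H)))).
- abstract (intros X Y f; rig_law (fun H i => merge_nat (fb (total H)) (hom i f))).
- abstract (intros X Y f; rig_law (fun H i => init_nat (fb (total H)) (hom i f))).
- abstract (intros X Y f; rig_law (fun H i => copy_nat (fb (total H)) (hom i f))).
- abstract (intros X Y f; rig_law (fun H i => discard_nat (fb (total H)) (hom i f))).
Defined.

Definition free_fb : fb_rig_category := @FbRigCategory free_rig_category free_biproduct.

End Free.

(** * The universal property of the free category *)

Section FreeSesquistrict.
Variables (S : Type) (Sig : rig_signature S).
Implicit Types (A : S) (X Y Z : rig_type S) (b : bool).

Local Notation D := (free_category Sig).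

Lemma free_arr_ext (f g : Arr D) : dom f = dom g -> cod f = cod g ->
  (forall (H : sesquistrict) (i : interpretation Sig H),
     ev i (arr_hom f) = ev i (arr_hom g)) -> f = g.
Proof.
destruct f as [X Y f], g as [X' Y' g]; simpl; intros <- <- h.
now rewrite (fhom_ext h).
Qed.

Lemma hiso_identity X Y (e : X = Y) : is_identity (C := D) (fwd (hiso Sig e)).
Proof.
destruct e; unfold is_identity; f_equal.
apply fhom_ext; intros H i; cbn [fwd hiso idm free_category].
now rewrite ev_cast, ev_id.
Qed.

Lemma free_strict : strict_rig (free_fb Sig).
Proof. repeat split; intros; apply hiso_identity. Qed.

Definition sort_category : category.
Proof.
refine (@Category S (@eq S) (@eq_refl S) (@eq_trans S) _ _ _);
  abstract (intros; subst; reflexivity).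
Defined.

Lemma sort_discrete : discrete sort_category.
Proof. intros A B e; simpl in e; now destruct e. Qed.

Definition free_incl : functor sort_category D.
Proof.
refine (@Functor sort_category D (fun A => [[A]])
  (fun A B e => fcast Sig (f_equal (fun A => [[A]]) e)) _ _).
- abstract (intro A; apply fhom_ext; intros H i; apply eq_trans with (1 := ev_cast _ _);
    symmetry; apply ev_id).
- abstract (intros A A' A'' e e'; destruct e, e'; apply fhom_ext; intros H i;
    cbn [comp free_category]; rewrite ev_comp, !ev_cast; symmetry; now apply acomp_idl).
Defined.

Lemma obj_sort (H : sesquistrict) (i : interpretation Sig H) A :
  obj i [[A]] = incl H (int_sort i A).
Proof. exact (sharp_class (int_sort i) (TSort A)). Qed.

(** The endpoints agree by the defining equation [req_distl] of polynomials, and the values agree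
    because [incl_distl] holds in every interpretation. *)
Lemma free_incl_distl A X Y : is_identity (distl (rig (free_fb Sig)) (free_incl A) X Y).
Proof.
pose proof (class_sound (req_distl A (rig_rep X) (rig_rep Y))) as e.
cbn [rig_class] in e; rewrite !class_rep in e.
apply free_arr_ext; [reflexivity | exact (eq_sym e) |].
intros H i; cbn [arr_hom distl rig free_fb frig free_rig_category
  free_rig_structure fdistl fwd idm free_category].
refine (eq_trans _ (eq_sym (ev_id i (type_tob true [[A]] (type_tob false X Y))))).
rewrite ev_raw; cbn [eval]; change (free_incl A) with [[A]].
now rewrite obj_sort, incl_distl, !obj_tob, obj_sort.
Qed.

Definition free_sesquistrict : sesquistrict :=
  @Sesquistrict sort_category sort_discrete (free_fb Sig) free_strict
    free_incl free_incl_distl.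

(** Supplies the endpoint conditions of [free_interpretation]: a sort is sent to its one-letter
    polynomial, from which words and their sums are rebuilt. *)
Lemma sharp_free X : sharp (R := free_fb Sig) (fun A => free_incl A) X = X.
Proof.
induction X as [|U X IH]; [reflexivity|].
apply (f_equal2 (@app (list S)) (x1 := _) (y1 := [U])); [|exact IH].
clear; induction U as [|A U IH]; [reflexivity|].
exact (f_equal (rig_type_mul [[A]]) IH).
Qed.

Definition free_generator (s : gen Sig) : Arr D :=
  @arr D (ar s) (coar s) (@fraw _ _ _ _ (RGen s) I eq_refl eq_refl).

Definition free_interpretation : interpretation Sig free_sesquistrict :=
  @Interpretation S Sig free_sesquistrict (fun A => A) free_generator
    (fun s => eq_sym (sharp_free (ar s))) (fun s => eq_sym (sharp_free (coar s))).

Section Extension.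
Variables (H : sesquistrict) (i : interpretation Sig H).

Definition free_functor : functor D (total H).
Proof.
refine (@Functor D (total H) (obj i) (fun X Y f => hom i f) _ _);
  abstract (intros; apply arr_inj; cbn [idm comp free_category];
    rewrite ?arr_comp, !arr_hom_ev, ?ev_id, ?ev_comp; reflexivity).
Defined.

Lemma free_functor_arr X Y (f : @Hom D X Y) : arr (fmap free_functor f) = ev i f.
Proof. apply arr_hom_ev. Qed.

Lemma free_functor_monoidal b :
  strict_monoidal_functor (free_monoidal Sig b) (monoidal_of (total H) b) free_functor.
Proof.
constructor; intros; rewrite ?arr_thom, ?free_functor_arr;
  cbn [fob free_functor tob tunit thom assoc lunit runit swap free_monoidal hiso fwd].
- apply obj_tob.
- apply obj_tunit.
- apply ev_ten.
- now rewrite ev_cast, arr_assoc_of, !obj_tob.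
- now rewrite ev_cast, arr_lunit_of, !obj_tob, obj_tunit.
- now rewrite ev_cast, arr_runit_of, !obj_tob, obj_tunit.
- apply ev_swap.
Qed.

Definition free_rig_functor : strict_rig_functor (free_fb Sig) (total H).
Proof.
refine (@StrictRigFunctor (free_fb Sig) (total H) free_functor
  (free_functor_monoidal true) (free_functor_monoidal false) _ _ _ _);
  abstract (intros; apply eq_trans with (1 := free_functor_arr _);
    cbn [distl distr annl annr rig free_fb frig free_rig_category free_rig_structure
         fdistl hiso fwd];
    rewrite ?ev_raw, ?ev_cast, ?arr_distr, ?arr_annl, ?arr_annr, ?obj_tob, ?obj_tunit;
    reflexivity).
Defined.

Definition free_base_functor : functor sort_category (base H).
Proof.
refine (@Functor sort_category (base H) (int_sort i)
  (fun A B e => match e in _ = B return Hom (int_sort i A) (int_sort i B) with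
                | eq_refl => idm (int_sort i A) end) _ _);
  abstract (intros; simpl in *; subst; rewrite ?comp_idl; reflexivity).
Defined.

Lemma sort_functor_eq (E : category) (F G : functor sort_category E) :
  (forall A, F A = G A) -> functor_eq F G.
Proof.
intro e; split; [exact e|]; intros [A B f]; simpl in f; destruct f.
change (farr F (aid (A : Ob sort_category)) = farr G (aid (A : Ob sort_category))).
now rewrite !farr_id, e.
Qed.

Definition free_extension : sesquistrict_functor free_sesquistrict H :=
  @SesquistrictFunctor free_sesquistrict H free_base_functor free_rig_functor
    (@sort_functor_eq (total H) (functor_comp free_base_functor (incl H))
       (functor_comp free_incl free_functor) (fun A => eq_sym (obj_sort i A))).

Lemma free_extension_extends : extends free_interpretation i free_extension.
Proof.
split; [reflexivity|]; intro s.
exact (eq_trans (free_functor_arr _) (ev_raw i _ _ _)).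
Qed.

Section Uniqueness.
Variable G : sesquistrict_functor free_sesquistrict H.
Hypothesis G_extends : extends free_interpretation i G.

(** Every polynomial is the class of a term, and [G] preserves both tensors and units. At a sort,
    compatibility with the inclusions reduces the claim to the base functor. *)
Lemma extension_obj X : on_total G X = obj i X.
Proof.
rewrite <- (class_rep X); unfold obj; rewrite sharp_class.
generalize (rig_rep X); clear X; intro t.
induction t as [A | | |t IHt u IHu|t IHt u IHu]; cbn [sharp_term].
- transitivity (incl H (on_base G A)).
  + symmetry; exact (proj1 (on_incl G) A).
  + exact (f_equal (incl H) (proj1 G_extends A)).
- exact (smf_tunit (srf_mul (on_total G))).
- exact (smf_tunit (srf_add (on_total G))).
- rewrite <- IHt, <- IHu; exact (smf_tob (srf_mul (on_total G)) _ _).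
- rewrite <- IHt, <- IHu; exact (smf_tob (srf_add (on_total G)) _ _).
Qed.

Lemma extension_monoidal b :
  strict_monoidal_functor (free_monoidal Sig b) (monoidal_of (total H) b) (on_total G).
Proof. destruct b; apply (on_total G). Qed.

(** Induction on the expression: its class is recognized as the corresponding operation of the free
    category, which [G] preserves. For the monoid and comonoid constructors that preservation is the
    derived one, as in [farr_merge]. *)
Lemma extension_arr X Y t (h : typed X Y t) :
  farr (on_total G) (@arr D _ _ (cls h)) = eval i t.
Proof.
(* Lets a class be replaced by any arrow of the free category with the same endpoints and the same
   values. *)
assert (e : forall (f : Arr D) X Y t (h : typed X Y t),
  dom f = X -> cod f = Y ->
  (forall (H : sesquistrict) (i : interpretation Sig H), ev i (arr_hom f) = eval i t) ->
  @arr D _ _ (cls h) = f).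
{ clear; intros f X Y t h <- <- e; apply free_arr_ext; trivial.
  intros H i; simpl; rewrite ev_cls; symmetry; apply e. }
revert X Y h; induction t as
  [s|X|t IHt u IHu|b t IHt u IHu|b X Y|X|X|X|X|X Y Z|X Y Z];
  intros X' Y' (wf & <- & <-); cbn [eval].
- rewrite (e (free_generator s)); trivial.
  + apply G_extends.
  + intros; apply ev_raw.
- rewrite (e (@aid D X)); trivial.
  + rewrite farr_id; f_equal; apply extension_obj.
  + intros; apply ev_id.
- destruct wf as (wt & wu & etu).
  pose (ht := conj wt (conj eq_refl eq_refl) : typed (rdom t) (rcod t) t).
  pose (hu := conj wu (conj (eq_sym etu) eq_refl) : typed (rcod t) (rcod u) u).
  rewrite (e (@arr D _ _ (@comp D _ _ _ (cls ht) (cls hu)))); trivial.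
  + now rewrite arr_comp, farr_acomp, IHt, IHu.
  + intros; apply eq_trans with (1 := ev_comp _ _ _); now rewrite !ev_cls.
- destruct wf as (wt & wu).
  pose (ht := conj wt (conj eq_refl eq_refl) : typed (rdom t) (rcod t) t).
  pose (hu := conj wu (conj eq_refl eq_refl) : typed (rdom u) (rcod u) u).
  rewrite (e (@arr D _ _ (thom (free_monoidal Sig b) (cls ht : @Hom D _ _) (cls hu)))); trivial.
  + now rewrite arr_thom, (farr_athom _ _ (extension_monoidal b)), IHt, IHu.
  + intros; apply eq_trans with (1 := ev_ten _ _ _ _); now rewrite !ev_cls.
- rewrite (e (@arr D _ _ (swap (free_monoidal Sig b) X Y))); trivial.
  + exact (eq_trans (smf_swap (extension_monoidal b) X Y)
      (f_equal2 (fun V W : Ob (total H) => arr (swap (monoidal_of (total H) b) V W))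
         (extension_obj X) (extension_obj Y))).
  + intros; apply ev_swap.
- rewrite (e (@arr D _ _ (merge (fb (free_fb Sig)) X))); trivial.
  + rewrite (farr_merge _ (fb (total H)) (proj1 (proj2 free_strict))
      (proj1 (proj2 (total_strict H))) (srf_add (on_total G))).
    now rewrite extension_obj.
  + intros; apply ev_raw.
- rewrite (e (@arr D _ _ (init (fb (free_fb Sig)) X))); trivial.
  + rewrite (farr_init _ (fb (total H)) (srf_add (on_total G))).
    now rewrite extension_obj.
  + intros; apply ev_raw.
- rewrite (e (@arr D _ _ (copy (fb (free_fb Sig)) X))); trivial.
  + rewrite (farr_copy _ (fb (total H)) (proj1 (proj2 free_strict))
      (proj1 (proj2 (total_strict H))) (srf_add (on_total G))).
    now rewrite extension_obj.
  + intros; apply ev_raw.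
- rewrite (e (@arr D _ _ (discard (fb (free_fb Sig)) X))); trivial.
  + rewrite (farr_discard _ (fb (total H)) (srf_add (on_total G))).
    now rewrite extension_obj.
  + intros; apply ev_raw.
- rewrite (e (@arr D _ _ (fdistl Sig X Y Z))); trivial.
  + rewrite <- !extension_obj; exact (srf_distl (on_total G) X Y Z).
  + intros; apply ev_raw.
- rewrite (e (@arr D _ _ (bwd (fdistl Sig X Y Z)))); trivial.
  + rewrite <- !extension_obj.
    apply (@fmap_bwd_arr _ _ (on_total G) _ _ _ _ (fdistl Sig X Y Z)).
    exact (srf_distl (on_total G) X Y Z).
  + intros; apply ev_raw.
Qed.

Lemma free_extension_unique : sesquistrict_functor_eq free_extension G.
Proof.
split.
- apply sort_functor_eq; intro A; symmetry; apply G_extends.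
- split; [intro X; symmetry; apply extension_obj|].
  intros [X Y f]; destruct (cls_surj f) as (t & h & ->).
  rewrite extension_arr; exact (eq_trans (free_functor_arr _) (ev_cls i h)).
Qed.

End Uniqueness.
End Extension.

Theorem free_sesquistrict_free : freely_generated Sig free_sesquistrict.
Proof.
exists free_interpretation; intros H i; exists (free_extension i).
split; [apply free_extension_extends | apply free_extension_unique].
Qed.

End FreeSesquistrict.

(** * Matrix entries as generators *)

Lemma strict_monoidal_functor_id (C : category) (M : symmetric_monoidal C) :
  strict_monoidal_functor M M (functor_id C).
Proof. now constructor. Qed.

Lemma strict_monoidal_functor_comp (C D E : category) (M : symmetric_monoidal C)
  (N : symmetric_monoidal D) (P : symmetric_monoidal E) (F : functor C D) (G : functor D E) :
  strict_monoidal_functor M N F -> strict_monoidal_functor N P G ->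
  strict_monoidal_functor M P (functor_comp F G).
Proof.
intros hF hG; constructor; intros.
- exact (eq_trans (f_equal G (smf_tob hF _ _)) (smf_tob hG _ _)).
- exact (eq_trans (f_equal G (smf_tunit hF)) (smf_tunit hG)).
- exact (eq_trans (f_equal (farr G) (smf_thom hF f g)) (smf_thom hG _ _)).
- exact (eq_trans (f_equal (farr G) (smf_assoc hF _ _ _)) (smf_assoc hG _ _ _)).
- exact (eq_trans (f_equal (farr G) (smf_lunit hF _)) (smf_lunit hG _)).
- exact (eq_trans (f_equal (farr G) (smf_runit hF _)) (smf_runit hG _)).
- exact (eq_trans (f_equal (farr G) (smf_swap hF _ _)) (smf_swap hG _ _)).
Qed.

Definition strict_rig_functor_id (R : rig_category) : strict_rig_functor R R.
Proof.
exact (@StrictRigFunctor R R (functor_id R) (strict_monoidal_functor_id _)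
  (strict_monoidal_functor_id _) (fun _ _ _ => eq_refl) (fun _ _ _ => eq_refl)
  (fun _ => eq_refl) (fun _ => eq_refl)).
Defined.

Definition strict_rig_functor_comp (R R' R'' : rig_category)
  (F : strict_rig_functor R R') (G : strict_rig_functor R' R'') : strict_rig_functor R R''.
Proof.
refine (@StrictRigFunctor R R'' (functor_comp F G)
  (strict_monoidal_functor_comp (srf_mul F) (srf_mul G))
  (strict_monoidal_functor_comp (srf_add F) (srf_add G)) _ _ _ _); intros.
- exact (eq_trans (f_equal (farr G) (srf_distl F _ _ _)) (srf_distl G _ _ _)).
- exact (eq_trans (f_equal (farr G) (srf_distr F _ _ _)) (srf_distr G _ _ _)).
- exact (eq_trans (f_equal (farr G) (srf_annl F _)) (srf_annl G _)).
- exact (eq_trans (f_equal (farr G) (srf_annr F _)) (srf_annr G _)).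
Defined.

Lemma functor_eq_sym (C D : category) (F G : functor C D) :
  functor_eq F G -> functor_eq G F.
Proof. now intros [h k]; split. Qed.

Lemma functor_eq_trans (C D : category) (F G K : functor C D) :
  functor_eq F G -> functor_eq G K -> functor_eq F K.
Proof.
intros [h k] [h' k']; split; intro X; [rewrite h | rewrite k]; auto.
Qed.

Definition sesquistrict_id (H : sesquistrict) : sesquistrict_functor H H.
Proof.
refine (@SesquistrictFunctor H H (functor_id _) (strict_rig_functor_id _) _).
now split.
Defined.

Definition sesquistrict_comp (H H' H'' : sesquistrict)
  (F : sesquistrict_functor H H') (G : sesquistrict_functor H' H'') :
  sesquistrict_functor H H''.
Proof.
refine (@SesquistrictFunctor H H'' (functor_comp (on_base F) (on_base G))
  (strict_rig_functor_comp (on_total F) (on_total G)) _).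
destruct (on_incl F) as [hF kF], (on_incl G) as [hG kG]; split; intro X.
- exact (eq_trans (hG _) (f_equal (on_total G) (hF X))).
- exact (eq_trans (kG (farr (on_base F) X)) (f_equal (farr (on_total G)) (kF X))).
Defined.

(** The usual argument: each round trip and the identity both extend the generating interpretation,
    hence agree. The assertion [inv] treats one round trip and is used twice with the roles
    exchanged. *)
Lemma freely_generated_unique (S : Type) (Sig : rig_signature S) (H H' : sesquistrict) :
  freely_generated Sig H -> freely_generated Sig H' -> isomorphic H H'.
Proof.
assert (inv : forall (H H' : sesquistrict) (i : interpretation Sig H)
  (i' : interpretation Sig H') (F : sesquistrict_functor H H')
  (G : sesquistrict_functor H' H),
  extends i i' F -> extends i' i G ->
  (forall (K : sesquistrict) (k : interpretation Sig K), exists E : sesquistrict_functor H K,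
     extends i k E /\ forall E', extends i k E' -> sesquistrict_functor_eq E E') ->
  functor_eq (functor_comp (on_base F) (on_base G)) (functor_id (base H)) /\
  functor_eq (functor_comp (on_total F) (on_total G)) (functor_id (total H))).
{ clear; intros H H' i i' F G [hF kF] [hG kG] univ.
  destruct (univ H i) as (E & _ & unique).
  destruct (unique (sesquistrict_comp F G)) as [ub ut].
  { split; [intro A | intro s].
    - exact (eq_trans (f_equal (on_base G) (hF A)) (hG A)).
    - exact (eq_trans (f_equal (farr (on_total G)) (kF s)) (kG s)). }
  destruct (unique (sesquistrict_id H)) as [vb vt].
  { split; [reflexivity|]; intro s; unfold farr; simpl.
    now destruct (int_gen i s). }
  split; eapply functor_eq_trans; eauto using functor_eq_sym. }
intros [i univ] [i' univ'].
destruct (univ H' i') as (F & hF & _), (univ' H i) as (G & hG & _).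
exists F, G.
destruct (inv H H' i i' F G hF hG univ), (inv H' H i' i G F hG hF univ').
repeat (split; [assumption|]); assumption.
Qed.

(** * The signature of matrix entries *)

Section Entries.
Variables (S : Type) (Sig : rig_signature S).

(** The bounds keep the default of [nth] from being reached. A generator whose arity or coarity is
    the zero polynomial contributes nothing, since its matrix is empty. *)
Definition entry_signature : rig_signature S :=
  @RigSignature S
    {p : gen Sig * nat * nat | snd (fst p) < length (ar (fst (fst p))) /\
                               snd p < length (coar (fst (fst p)))}
    (fun p => [nth (snd (fst (proj1_sig p))) (ar (fst (fst (proj1_sig p)))) []])
    (fun p => [nth (snd (proj1_sig p)) (coar (fst (fst (proj1_sig p)))) []]).

Lemma entry_signature_monoidal : is_monoidal entry_signature.
Proof. intro p; split; eexists; reflexivity. Qed.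

Section Words.
Variables (H : sesquistrict) (a : S -> Ob (base H)).

Definition word_obj (U : list S) : Ob (total H) :=
  fold_right (fun A Y => incl H (a A) ⊗ Y) 𝟙 U.

Lemma sharp_asum (P : rig_type S) :
  sharp (fun A => incl H (a A)) P = asum (add (total H)) (map word_obj P).
Proof. induction P as [|U P IH]; [reflexivity|]; simpl; now rewrite IH. Qed.

Lemma add_strict : strict_monoidal (add (total H)).
Proof. apply (total_strict H). Qed.

Lemma nth_word_obj (P : rig_type S) m : m < length P ->
  nth m (map word_obj P) 𝟘 = sharp (fun A => incl H (a A)) [nth m P []].
Proof.
(* In range the default is immaterial; it is changed from the zero object to the image of the empty
   word, the form that [map_nth] expects. *)
intro hm; rewrite nth_indep with (d' := word_obj []) by now rewrite length_map.
rewrite map_nth; symmetry; apply (tob1r add_strict).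
Qed.

End Words.

Section Interpretations.
Variable H : sesquistrict.

Definition entries (i : interpretation Sig H) : interpretation entry_signature H.
Proof.
refine (@Interpretation S entry_signature H (int_sort i) (fun p =>
  entry (fb (total H)) (map (word_obj (int_sort i)) (ar (fst (fst (proj1_sig p)))))
    (map (word_obj (int_sort i)) (coar (fst (fst (proj1_sig p)))))
    (int_gen i (fst (fst (proj1_sig p)))) (snd (fst (proj1_sig p))) (snd (proj1_sig p))) _ _);
  intros [[[s m] n] [hm hn]]; simpl fst; simpl snd.
- rewrite dom_entry by apply add_strict; now apply nth_word_obj.
- rewrite cod_entry; [now apply nth_word_obj | apply add_strict | |].
  + now rewrite int_dom, sharp_asum.
  + now rewrite int_cod, sharp_asum.
Defined.

(** Each prescribed family of entries is assembled into an arrow by [matrix]. Only sorts and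
    generators are compared, which is all that [extends] looks at. *)
Lemma entries_surj (j : interpretation entry_signature H) :
  exists i : interpretation Sig H,
    int_sort i = int_sort j /\ forall p, int_gen (entries i) p = int_gen j p.
Proof.
pose (words P := map (word_obj (int_sort j)) P).
(* Indices out of range name no generator of the entry signature, so an arbitrary arrow fills those
   places. *)
pose (g s m n := match excluded_middle_informative
    (m < length (ar s) /\ n < length (coar s)) with
  | left h => int_gen j (exist _ (s, m, n) h)
  | right _ => aid 𝟘
  end).
assert (r : forall s : gen Sig, {f : Arr (total H) |
  dom f = asum (add (total H)) (words (ar s)) /\
  cod f = asum (add (total H)) (words (coar s)) /\
  forall m n, m < length (words (ar s)) -> n < length (words (coar s)) ->
    entry (fb (total H)) (words (ar s)) (words (coar s)) f m n = g s m n}).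
{ intro s; apply matrix; [apply add_strict|].
  unfold words; rewrite !length_map; intros m n hm hn; unfold g.
  destruct excluded_middle_informative as [h|h]; [|now destruct h].
  rewrite int_dom, int_cod; split; symmetry; now apply nth_word_obj. }
unshelve eexists (@Interpretation S Sig H (int_sort j) (fun s => proj1_sig (r s)) _ _).
- intro s; rewrite sharp_asum; apply (proj2_sig (r s)).
- intro s; rewrite sharp_asum; apply (proj2_sig (r s)).
- split; [reflexivity|]; intros [[[s m] n] [hm hn]]; simpl.
  destruct (r s) as (f & df & cf & hf); simpl; simpl in hm, hn.
  transitivity (g s m n).
  + apply hf; unfold words; now rewrite length_map.
  + unfold g; destruct excluded_middle_informative as [h|h]; [|now destruct h].
    do 2 f_equal; apply proof_irrelevance.
Qed.

End Interpretations.

Section Extends.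
Variables (H H' : sesquistrict) (F : sesquistrict_functor H H').
Variables (i : interpretation Sig H) (i' : interpretation Sig H').

Lemma fob_word_obj (U : list S) :
  (forall A, on_base F (int_sort i A) = int_sort i' A) ->
  on_total F (word_obj (int_sort i) U) = word_obj (int_sort i') U.
Proof.
intro e; induction U as [|A U IH]; simpl; [apply (srf_mul (on_total F))|].
rewrite (smf_tob (srf_mul (on_total F))), IH, <- e; f_equal.
symmetry; exact (proj1 (on_incl F) (int_sort i A)).
Qed.

Lemma map_word_obj (P : rig_type S) :
  (forall A, on_base F (int_sort i A) = int_sort i' A) ->
  map (on_total F) (map (word_obj (int_sort i)) P) = map (word_obj (int_sort i')) P.
Proof.
intro e; rewrite map_map; apply map_ext; intro U; now apply fob_word_obj.
Qed.

Lemma farr_entries p :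
  (forall A, on_base F (int_sort i A) = int_sort i' A) ->
  farr (on_total F) (int_gen (entries i) p) =
  entry (fb (total H')) (map (word_obj (int_sort i')) (ar (fst (fst (proj1_sig p)))))
    (map (word_obj (int_sort i')) (coar (fst (fst (proj1_sig p)))))
    (farr (on_total F) (int_gen i (fst (fst (proj1_sig p)))))
    (snd (fst (proj1_sig p))) (snd (proj1_sig p)).
Proof.
intro e; simpl.
rewrite (farr_entry _ (fb (total H')) (srf_add (on_total F))).
- now rewrite !map_word_obj.
- now rewrite int_dom, sharp_asum.
- now rewrite int_cod, sharp_asum.
Qed.

(** Taking entries is natural, since [F] preserves injections and projections, and faithful, since
    an arrow between sums is determined by its entries. *)
Lemma extends_entries : extends i i' F <-> extends (entries i) (entries i') F.
Proof.
split; intros [e h]; (split; [exact e|]).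
- intro p; rewrite farr_entries, h by exact e; reflexivity.
- intro s.
  apply (entry_ext (B := fb (total H')) (add_strict H')
    (Xs := map (word_obj (int_sort i')) (ar s))
    (Ys := map (word_obj (int_sort i')) (coar s))).
  + rewrite <- (map_word_obj _ e), <- (fob_asum (srf_add (on_total F))).
    rewrite <- sharp_asum, <- int_dom.
    reflexivity.
  + rewrite <- (map_word_obj _ e), <- (fob_asum (srf_add (on_total F))).
    rewrite <- sharp_asum, <- int_cod.
    reflexivity.
  + now rewrite int_dom, sharp_asum.
  + now rewrite int_cod, sharp_asum.
  + rewrite !length_map; intros m n hm hn.
    pose (p := exist _ (s, m, n) (conj hm hn) : gen entry_signature).
    exact (eq_trans (eq_sym (farr_entries p e)) (h p)).
Qed.

End Extends.

(** An interpretation [j] of the entry signature comes from some [i'] by [entries_surj], and the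
    functors extending to [j] are exactly those extending to [i']. Existence and uniqueness carry
    over with [H] unchanged. *)
Lemma freely_generated_entries (H : sesquistrict) :
  freely_generated Sig H -> freely_generated entry_signature H.
Proof.
intros [i univ]; exists (entries i); intros H' j.
destruct (entries_surj j) as (i' & es & eg).
assert (ext : forall F : sesquistrict_functor H H',
  extends i i' F <-> extends (entries i) j F).
{ intro F; rewrite extends_entries; unfold extends; simpl int_sort; rewrite es.
  split; intros [h k]; (split; [exact h|]); intro p; rewrite k; auto. }
destruct (univ H' i') as (F & hF & unique); exists F.
split; [now apply ext|]; intros G hG; now apply unique, ext.
Qed.

End Entries.

Theorem theorem4p10 (S : Type) (Sig : rig_signature S) :
  exists SigM : rig_signature S,
    is_monoidal SigM /\
    (exists H : sesquistrict, freely_generated Sig H) /\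
    (exists HM : sesquistrict, freely_generated SigM HM) /\
    (forall H HM : sesquistrict,
       freely_generated Sig H -> freely_generated SigM HM -> isomorphic H HM).
Proof.
exists (entry_signature Sig).
split; [apply entry_signature_monoidal|].
split; [exists (free_sesquistrict Sig); apply free_sesquistrict_free|].
split; [exists (free_sesquistrict Sig)|].
- apply freely_generated_entries, free_sesquistrict_free.
(* Both categories are free over the entry signature, so uniqueness over that one signature
   suffices. *)
- intros H HM h hM; apply (freely_generated_unique (freely_generated_entries h) hM).
Qed.
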